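(* Let $m,n\geq 1$, let $\Omega\subset\mathbb{R}^m$ be a smoothly bounded domain, and let $\{A_\tau\}_{\tau\in\partial\Omega}$ be a continuous family of convex bodies in $\mathbb{R}^n$. For $x\in\Omega$ let $A_x:=\int_{\partial\Omega}A_\tau\,d\mu_x(\tau)$ be the harmonic interpolation of $\{A_\tau\}_{\tau\in\partial\Omega}$, where $\mu_x$ is the harmonic measure on $\partial\Omega$ with respect to $x$. Then the map $x\mapsto |A_x|^{1/n}$ is superharmonic on $\Omega$.
   Context: A smoothly bounded domain is a bounded, connected open set with smooth boundary. A convex body is a nonempty compact convex set (it may have empty interior). $|\cdot|$ denotes the Euclidean volume (Lebesgue measure) on $\mathbb{R}^n$. A family of convex bodies is continuous if it is continuous in its parameter with respect to the Hausdorff metric. The support function of a convex body $A\subset\mathbb{R}^n$ is $h_A(\xi)=\sup_{\zeta\in A}\zeta\cdot\xi$, $\xi\in\mathbb{R}^n$. It is convex and positively homogeneous of degree one, and every finite function $h$ on $\mathbb{R}^n$ with these two properties is the support function of a unique convex body, denoted $A(h)$. Minkowski integral: if $D\subset\mathbb{R}^m$ is compact, $\mu$ is a Radon measure on $D$ and $\{A_y\}_{y\in D}$ is a continuous family of convex bodies in $\mathbb{R}^n$, then $\int_D A_y\,d\mu(y):=A\left(\int_D h_{A_y}\,d\mu(y)\right)$, i.e. the convex body whose support function is $\xi\mapsto\int_D h_{A_y}(\xi)\,d\mu(y)$. The harmonic measure $\mu_x$ ($x\in\Omega$) is the Borel probability measure on $\partial\Omega$ such that for every continuous $f:\partial\Omega\to\mathbb{R}$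 the function $x\mapsto\int_{\partial\Omega}f\,d\mu_x$ is the harmonic function on $\Omega$ with boundary values $f$. *)

(* Defs.v *)
From HB Require Import structures.
From mathcomp Require Import all_boot all_order all_algebra.
From mathcomp Require Import all_classical all_reals all_analysis.
From mathcomp Require Import lra.

Set Implicit Arguments.
Unset Strict Implicit.
Unset Printing Implicit Defensive.

Import Order.TTheory GRing.Theory Num.Theory.
Import numFieldNormedType.Exports.

Local Open Scope classical_set_scope.
Local Open Scope ring_scope.

Notation borel R n := (g_sigma_algebraType (@open 'rV[R]_n)).

Section lebesgue.
Variable R : realType.
Implicit Types n : nat.

Definition rV_cons n (tv : R * 'rV[R]_n) : 'rV[R]_n.+1 :=
  row_mx tv.1%:M tv.2 : 'rV_(1 + n).

(* The iterated product of the one-dimensional Lebesgue measure, carried to the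
   Borel sets of 'rV[R]_n along [rV_cons] *)
Fixpoint lebesgue_rV n : set (borel R n) -> \bar R :=
  if n is n'.+1 then
    pushforward (product_measure1 (@lebesgue_measure R) (@lebesgue_rV n'))
      (@rV_cons n' : _ -> borel R n'.+1)
  else \d_(0 : borel R 0).

Lemma rV_cons0 n (tv : R * 'rV[R]_n) i (j : 'I_1) :
  rV_cons tv i (lshift n j : 'I_(1 + n)) = tv.1.
Proof. by apply: (etrans (row_mxEl _ _ _ _)); rewrite !ord1 mxE eqxx mulr1n. Qed.

Lemma rV_consS n (tv : R * 'rV[R]_n) i j :
  rV_cons tv i (rshift 1 j : 'I_(1 + n)) = tv.2 i j.
Proof. exact: row_mxEr. Qed.

Lemma ball_rV_cons n (a b : R) (v w : 'rV[R]_n) (e : R) : 0 < e ->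
  ball (rV_cons (a, v)) e (rV_cons (b, w)) <-> ball a e b /\ ball v e w.
Proof.
move=> e0; split.
- case=> _ H; split.
    by have := H ord0 (lshift n ord0 : 'I_(1 + n)); rewrite !rV_cons0.
  split=> // i j.
  by have := H i (rshift 1 j : 'I_(1 + n)); rewrite !rV_consS.
- move=> [H1 [_ H2]]; split=> // i j.
  case: (@split_ordP 1 n j) => k ->.
    by rewrite !rV_cons0.
  by rewrite !rV_consS.
Qed.

Lemma measurable_rV_cons n :
  measurable_fun [set: R * borel R n] (@rV_cons n : _ -> borel R n.+1).
Proof.
apply: (@measurability _ _ _ (borel R n.+1) _ _ (@open 'rV[R]_n.+1)) => //.
move=> _ [U oU <-]; rewrite setTI.
pose r (k : nat) : R := k.+1%:R^-1.
have r0 k : 0 < r k by rewrite invr_gt0.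
pose box (i : rat * 'rV[rat]_n * nat) : set (R * borel R n) :=
  ball (ratr i.1.1 : R) (r i.2) `*`
  (ball (map_mx (@ratr R) i.1.2 : 'rV[R]_n) (r i.2) : set (borel R n)).
pose P := [set i | box i `<=` (@rV_cons n) @^-1` U].
have -> : (@rV_cons n : R * borel R n -> borel R n.+1) @^-1` U = \bigcup_(i in P) box i.
  apply/seteqP; split=> [[t v] /= Utv|x [i Pi /Pi]//].
  have : nbhs (rV_cons (t, v)) U by exact: open_nbhs_nbhs.
  move=> /nbhs_ballP[e /= e0 eU].
  have [k] : exists k, r k + r k < e.
    have e20 : 0 < e / 2 by rewrite divr_gt0.
    have [N _ /(_ N (leqnn N))] := near_infty_natSinv_lt (PosNum e20).
    by rewrite /= => H; exists N; rewrite (splitr e) ltrD.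
  move=> ke.
  have ex (x : R) : exists q : rat, ball (ratr q : R) (r k) x.
    have /rat_in_itvoo[q] : x - r k < x + r k by rewrite ltrD2l gtrN.
    rewrite in_itv /= => /andP[h1 h2]; exists q.
    by rewrite /ball /= ltr_distl; apply/andP; split; lra.
  have [q hq] := ex t.
  have [s hs] : exists s : 'rV[rat]_n, ball (map_mx (@ratr R) s : 'rV[R]_n) (r k) v.
    have /choice[g hg] := fun j => ex (v ord0 j).
    exists (\row_j g j); split=> // i j; rewrite !mxE ord1; exact: hg.
  exists (q, s, k); last by split.
  move=> [t' v'] [/= tq vs]; apply: eU.
  apply: (le_ball (ltW ke)).
  apply/ball_rV_cons; first exact: addr_gt0.
  split.
    by apply: (@ball_triangle _ _ (ratr q : R) _ _ _ _ _ tq); exact: ball_sym.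
  by apply: (@ball_triangle _ _ (map_mx (@ratr R) s : 'rV[R]_n) _ _ _ _ _ vs); exact: ball_sym.
rewrite bigcup_mkcond; apply: countable_bigcupT_measurable => [|i].
  exact: countableP.
case: ifPn => _; last exact: measurable0.
apply: measurableX; first by apply: measurable_realfun.open_measurable; exact: ball_open.
by apply: sub_sigma_algebra; exact: ball_open.
Qed.

Lemma sigma_finite_ball n (mu : {measure set (borel R n) -> \bar R}) :
  (forall k : nat, mu (ball (0 : 'rV[R]_n) k.+1%:R)%R < +oo)%E ->
  sigma_finite [set: borel R n] mu.
Proof.
move=> mufin; exists (fun k => ball (0 : 'rV[R]_n) k.+1%:R).
  apply/esym; rewrite -subTset => v _.
  have := archi_boundP (normr_ge0 (v : 'rV[R]_n)).
  set N := Num.bound _ => vN; exists N => //=.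
  rewrite mx_norm_ball /ball_ /= sub0r normrN (lt_le_trans vN)//.
  by rewrite ler_nat.
by move=> k; split=> //; apply: sub_sigma_algebra; exact: ball_open.
Qed.

Lemma lebesgue_rV_spec n : exists2 mu : {measure set (borel R n) -> \bar R},
  mu = @lebesgue_rV n :> (set _ -> _) &
  forall k : nat, (mu (ball (0 : 'rV[R]_n) k.+1%:R)%R < +oo)%E.
Proof.
elim: n => [|n [mu muE mufin]].
  exists (\d_(0 : borel R 0)) => // k.
  by rewrite /= diracE; case: (_ \in _); rewrite ltry.
have sf := sigma_finite_ball mufin.
pose H1 := isSFinite.Build _ _ _ _ (sfinite_measure_sigma_finite sf).
pose H2 := isSigmaFinite.Build _ _ _ _ sf.
pose nu := HB.pack_for (SigmaFiniteMeasure.type (borel R n) R)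
  (Measure.sort mu) H1 H2.
have nuE : nu = @lebesgue_rV n :> (set (borel R n) -> \bar R) by rewrite -muE.
exists (measure_function_pushforward__canonical__measure_function_Measure
  (product_measure1 (@lebesgue_measure R) nu) (@measurable_rV_cons n)).
  by rewrite /= -nuE.
move=> k; rewrite /= /pushforward.
have -> : (@rV_cons n : R * borel R n -> borel R n.+1) @^-1` (ball 0 k.+1%:R) =
    ball (0 : R) k.+1%:R `*` (ball (0 : 'rV[R]_n) k.+1%:R : set (borel R n)).
  have r0 : rV_cons (0, 0) = 0 :> 'rV[R]_n.+1.
    apply/rowP => j; case: (@split_ordP 1 n j) => i ->.
      by rewrite rV_cons0 mxE.
    by rewrite rV_consS !mxE.
  by rewrite -r0; apply/seteqP; split => -[t v] /ball_rV_cons; apply.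
rewrite (@product_measure1E _ _ _ (borel R n) R (@lebesgue_measure R) nu)//.
- have fb : @lebesgue_measure R (ball (0 : R) k.+1%:R) \is a fin_num.
    by rewrite lebesgue_measure_ball.
  by apply: lte_mul_pinfty; [exact: measure_ge0|exact: fb|exact: mufin].
- by apply: measurable_realfun.open_measurable; exact: ball_open.
- by apply: sub_sigma_algebra; exact: ball_open.
Qed.

Section instances.
Variable n : nat.

Let lebesgue_rV0 : @lebesgue_rV n set0 = 0%E.
Proof. by have [mu <- _] := lebesgue_rV_spec n; exact: measure0. Qed.

Let lebesgue_rV_ge0 A : (0 <= @lebesgue_rV n A)%E.
Proof. by have [mu <- _] := lebesgue_rV_spec n; exact: measure_ge0. Qed.

Let lebesgue_rV_additive : semi_sigma_additive (@lebesgue_rV n).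
Proof.
by have [mu <- _] := lebesgue_rV_spec n; exact: measure_semi_sigma_additive.
Qed.

HB.instance Definition _ := isMeasure.Build _ _ _ (@lebesgue_rV n)
  lebesgue_rV0 lebesgue_rV_ge0 lebesgue_rV_additive.

Let lebesgue_rV_sigma_finite : sigma_finite setT (@lebesgue_rV n).
Proof.
by have [mu <- mufin] := lebesgue_rV_spec n; exact: sigma_finite_ball.
Qed.

HB.instance Definition _ := Measure_isSigmaFinite.Build _ _ _ (@lebesgue_rV n)
  lebesgue_rV_sigma_finite.

End instances.

End lebesgue.

Section euclidean.
Variables (R : realType) (n : nat).
Implicit Types (x y xi : 'rV[R]_n) (r : R).

Definition dot x y : R := \sum_(i < n) x ord0 i * y ord0 i.

(* The library norm and [ball] of 'rV[R]_n are those of the sup norm *)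
Definition enorm x : R := Num.sqrt (dot x x).

Definition eball x r : set 'rV[R]_n := [set y | enorm (y - x) < r].

Definition closed_eball x r : set 'rV[R]_n := [set y | enorm (y - x) <= r].

End euclidean.

Section convex_bodies.
Variables (R : realType) (n : nat).
Implicit Types A B : set 'rV[R]_n.

Definition convex_body A :=
  [/\ A !=set0, compact A & convex_set (A : set (convex_lmodType 'rV[R]_n))].

Definition support_function A (xi : 'rV[R]_n) : R :=
  sup [set dot zeta xi | zeta in A].

(* [set0] is only a default value, for when no convex body has support
   function [h] *)
Definition body_of_support (h : 'rV[R]_n -> R) : set 'rV[R]_n :=
  xget set0 [set A | convex_body A /\ support_function A = h].

Definition enlargement A (e : R) : set 'rV[R]_n :=
  [set y | exists2 x, A x & enorm (y - x) <= e].

Definition hausdorff_distance A B : R :=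
  inf [set e | [/\ 0 <= e, A `<=` enlargement B e & B `<=` enlargement A e]].

End convex_bodies.

Section families.
Variables (R : realType) (m n : nat).
Implicit Types (D : set 'rV[R]_m) (A : 'rV[R]_m -> set 'rV[R]_n).

Definition continuous_family D A :=
  forall t, D t ->
    hausdorff_distance (A s) (A t) @[s --> within D (nbhs t)] --> (0 : R).

Definition minkowski_integral D (mu : {measure set (borel R m) -> \bar R}) A :=
  body_of_support
    (fun xi => (\int[mu]_(t in D) support_function (A t) xi)%R).

End families.

Section domains.
Variables (R : realType) (m : nat).
Implicit Types (U Omega : set 'rV[R]_m) (f u : 'rV[R]_m -> R).

Definition boundary Omega : set 'rV[R]_m := closure Omega `\` interior Omega.

Definition unit_vector (i : 'I_m) : 'rV[R]_m := delta_mx ord0 i.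

Definition partial (i : 'I_m) f : 'rV[R]_m -> R :=
  fun x => 'D_(unit_vector i) f x.

(* meant for [U] open *)
Fixpoint continuously_differentiable (k : nat) U f : Prop :=
  if k is k'.+1 then
    (forall x, U x -> {for x, continuous f}) /\
    forall i, (forall x, U x -> derivable f x (unit_vector i)) /\
      continuously_differentiable k' U (partial i f)
  else forall x, U x -> {for x, continuous f}.

Definition smooth U f := forall k, continuously_differentiable k U f.

Definition smooth_boundary Omega :=
  forall p, boundary Omega p -> exists U (rho : 'rV[R]_m -> R),
    [/\ open U, U p, smooth U rho,
        (forall x, U x -> exists i, partial i rho x != 0) &
        Omega `&` U = [set x | U x /\ rho x < 0]].

Definition smoothly_bounded_domain Omega :=
  [/\ bounded_set Omega, open Omega, connected Omega & smooth_boundary Omega].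

Definition laplacian f : 'rV[R]_m -> R :=
  fun x => \sum_(i < m) partial i (partial i f) x.

Definition harmonic_on Omega u :=
  continuously_differentiable 2 Omega u /\
  forall x, Omega x -> laplacian u x = 0.

Definition boundary_values Omega u f :=
  forall t, boundary Omega t -> u x @[x --> within Omega (nbhs t)] --> f t.

(* A Borel probability measure on the closed set [boundary Omega] is encoded as
   one on the whole space that gives [boundary Omega] mass 1; [mu x] is
   unconstrained for [x] outside [Omega] *)
Definition harmonic_measure Omega (mu : 'rV[R]_m -> probability (borel R m) R) :=
  (forall x, Omega x -> mu x (boundary Omega) = 1%E) /\
  forall f, {within boundary Omega, continuous f} ->
    let u x := (\int[mu x]_(t in boundary Omega) f t)%R in
    harmonic_on Omega u /\ boundary_values Omega u f.

Definition superharmonic Omega u :=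
  (forall (x : 'rV[R]_m) (a : R), Omega x -> a < u x -> \forall y \near x, a < u y) /\
  (forall (x : 'rV[R]_m) (r : R), 0 < r -> closed_eball x r `<=` Omega ->
    (\int[@lebesgue_rV R m]_(y in eball x r) (u y)%:E <=
      @lebesgue_rV R m (eball x r) * (u x)%:E)%E).

End domains.

Definition harmonic_interpolation (R : realType) (m n : nat)
    (Omega : set 'rV[R]_m) (mu : 'rV[R]_m -> probability (borel R m) R)
    (A : 'rV[R]_m -> set 'rV[R]_n) (x : 'rV[R]_m) : set 'rV[R]_n :=
  minkowski_integral (boundary Omega) (mu x) A.

(* Main.v *)
(* Write [A(h)] for the body [{z | forall xi, z.xi <= h xi}] of a sublinear function [h]
   and [V h = |A(h)|^(1/n)].  The support function [h_x] of [A_x] is, for each fixed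
   direction, a harmonic function of [x], so by the mean value property [h_x] is the
   average of [h_y] over a ball around [x].  By the Brunn-Minkowski inequality [V] is
   concave and homogeneous, so a Riemann-sum argument gives that [V h_x] is at least the
   average of [V h_y].  Lower semicontinuity holds because a body of positive volume
   contains a ball, so that slightly shrunken copies of it lie in all nearby bodies.

   Brunn-Minkowski is proved by induction on the dimension: after rescaling the slice
   volumes by their suprema, their superlevel sets are intervals, for which the inequality
   is trivial.  The mean value property over a ball of centre [x] and radius [r] follows
   from [u y - u x = \int_0^1 grad u (x + s (y - x)) . (y - x) ds], where for each [s] the
   integral over [y] vanishes: up to a multiple of the Laplacian the integrand is the
   divergence of [(|y - x|^2 - r^2)/2 * grad u (x + s (y - x))], which is zero on the sphere. *)
From HB Require Import structures.
From mathcomp Require Import all_boot all_order all_algebra.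
From mathcomp Require Import all_classical all_reals all_analysis.
From mathcomp Require Import measurable_realfun ring lra.
Require Import Defs.
Set Implicit Arguments.
Unset Strict Implicit.
Unset Printing Implicit Defensive.
Import Order.TTheory GRing.Theory Num.Theory.
Import numFieldNormedType.Exports.
Local Open Scope classical_set_scope.
Local Open Scope ring_scope.

(** * The one-dimensional Brunn-Minkowski inequality *)

(** Slice volumes with different suprema cannot be compared level by level: above the smaller
    supremum one superlevel set is empty and the sum of the two gives nothing. With both suprema
    equal to 1 every level in ]0, 1[ is usable; the price is a weighted power mean inequality at the
    end.

    The Riemann sums need [h_y] close to [h_c] uniformly in the direction, while harmonicity only
    gives continuity for each fixed direction. Sublinearity bridges the gap: bounds at the vectors
    [± e_i] give a common Lipschitz constant. The error is a multiple of the 1-norm, itself a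
    support function, so adding it stays within convex bodies; continuity of the measure from above
    finally removes it. Lower semicontinuity has to subtract the error instead, and this is where an
    inner ball is needed: a body of positive volume lies in none of its supporting hyperplanes.

    The mean value property is taken over solid balls, so that Fubini reduces the divergence theorem
    to the fundamental theorem of calculus on chords, without a surface measure. *)

Section one_dimensional_brunn_minkowski.
Variable R : realType.
Implicit Types (I J L : set R) (phi : R -> R) (psi : R -> \bar R).
Local Notation leb := (@lebesgue_measure R).

(** Convexity of the power [p.+1] with weights [u], [v], cleared of denominators. The induction step
    is Chebyshev's sum inequality: [x ^+ p.+1 - y ^+ p.+1] and [x - y] have the same sign. *)
Lemma power_mean_ineq (p : nat) (u v x y : R) :
  0 <= u -> 0 <= v -> 0 <= x -> 0 <= y ->
  (u * x + v * y) ^+ p.+1 <= (u + v) ^+ p * (u * x ^+ p.+1 + v * y ^+ p.+1).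
Proof.
move=> u0 v0 x0 y0; elim: p => [|p IH]; first by rewrite expr0 mul1r !expr1.
have h0 : 0 <= u * x + v * y by rewrite addr_ge0// mulr_ge0.
rewrite exprSr (le_trans (ler_wpM2r h0 IH))// [in leRHS](exprSr (u + v)) -!mulrA ler_wpM2l//.
  by rewrite exprn_ge0// addr_ge0.
rewrite -subr_ge0.
have -> : (u + v) * (u * x ^+ p.+2 + v * y ^+ p.+2) -
   (u * x ^+ p.+1 + v * y ^+ p.+1) * (u * x + v * y) =
   (u * v) * ((x ^+ p.+1 - y ^+ p.+1) * (x - y)) by rewrite !exprS; ring.
apply: mulr_ge0; first exact: mulr_ge0.
have [xy|yx] := leP x y.
  by rewrite mulr_le0// subr_le0// lerXn2r.
by rewrite mulr_ge0// subr_ge0 ?ltW// ltrXn2r.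
Qed.

Definition segment_closed I :=
  forall x y theta, I x -> I y -> 0 <= theta <= 1 -> I ((1 - theta) * x + theta * y).

Lemma segment_closed_interval I : segment_closed I -> is_interval I.
Proof.
move=> cI x y Ix Iy z /andP[xz zy].
have [xy|xy] := eqVneq x y.
  by move: zy; rewrite -xy => zx; have -> : z = x by apply: le_anti; rewrite zx.
have yx : 0 < y - x by rewrite subr_gt0 lt_neqAle xy (le_trans xz).
have -> : z = (1 - (z - x) / (y - x)) * x + (z - x) / (y - x) * y.
  by field; rewrite gt_eqF.
apply: cI => //; apply/andP; split; first by rewrite divr_ge0 ?subr_ge0// (le_trans xz).
by rewrite ler_pdivrMr// mul1r lerB.
Qed.

Lemma lebesgue_interval_le I (M : R) : is_interval I -> I !=set0 ->
  (forall x, I x -> `|x| <= M) -> (leb I <= (sup I - inf I)%:E)%E.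
Proof.
move=> iI [x0 Ix0] bI.
have hu : has_ubound I by exists M => x /bI; rewrite ler_norml => /andP[].
have hl : has_lbound I by exists (- M) => x /bI; rewrite ler_norml => /andP[].
have sub : I `<=` [set` `[inf I, sup I]].
  by move=> x Ix /=; rewrite in_itv/= ge_inf//= ub_le_sup.
have : (leb I <= leb [set` `[inf I, sup I]])%E.
  by apply: le_measure; rewrite ?inE//; exact: is_interval_measurable.
move=> /le_trans; apply.
rewrite lebesgue_measure_itv/= lte_fin; case: ifPn => // h.
by rewrite lee_fin subr_ge0 (le_trans (ge_inf hl Ix0))// ub_le_sup.
Qed.

(** The open interval between the combined infima and the combined suprema lies in [L], and its
    length is at least the left-hand side. [L] is any measurable set containing the combination of
    [I] and [J], so measurability of the Minkowski sum is never at issue. *)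
Lemma lebesgue_interval_sum I J L (l m M : R) :
  0 <= l -> 0 <= m -> segment_closed I -> segment_closed J ->
  I !=set0 -> J !=set0 ->
  (forall x, I x -> `|x| <= M) -> (forall x, J x -> `|x| <= M) ->
  measurable L -> (forall s t, I s -> J t -> L (l * s + m * t)) ->
  (l%:E * leb I + m%:E * leb J <= leb L)%E.
Proof.
move=> l0 m0 cI cJ I0 J0 bI bJ mL IJL.
have iI := segment_closed_interval cI; have iJ := segment_closed_interval cJ.
have hsup K : K !=set0 -> (forall x, K x -> `|x| <= M) -> has_sup K /\ has_inf K.
  move=> K0 bK; split; split => //.
    by exists M => x /bK; rewrite ler_norml => /andP[].
  by exists (- M) => x /bK; rewrite ler_norml => /andP[].
have [sI nI] := hsup _ I0 bI; have [sJ nJ] := hsup _ J0 bJ.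
set a := l * inf I + m * inf J; set b := l * sup I + m * sup J.
apply: (@le_trans _ _ (b - a)%:E).
  have -> : (b - a)%:E = (l%:E * (sup I - inf I)%:E + m%:E * (sup J - inf J)%:E)%E.
    by rewrite -!EFinM -EFinD; congr (_%:E); rewrite /a /b; ring.
  apply: leeD; apply: lee_wpmul2l; rewrite ?lee_fin//.
    exact: (lebesgue_interval_le iI I0 bI).
  exact: (lebesgue_interval_le iJ J0 bJ).
have sub : [set` `]a, b[] `<=` L.
  move=> z /=; rewrite in_itv/= => /andP[az zb].
  have [s0 Is0 [t0 Jt0 h0]] : exists2 s0, I s0 & exists2 t0, J t0 & l * s0 + m * t0 < z.
    (* Near-infima within [d] shift the combination by at most [d * (l + m) < z - a]; the summand 1
       keeps the divisor positive. *)
    pose d := (z - a) / (l + m + 1).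
    have lm : 0 < l + m + 1 by rewrite ltr_wpDl// addr_ge0.
    have d0 : 0 < d by rewrite divr_gt0// subr_gt0.
    have [s Is sd] := inf_adherent d0 nI; have [t Jt td] := inf_adherent d0 nJ.
    exists s => //; exists t => //.
    have h1 := ler_wpM2l l0 (ltW sd); have h2 := ler_wpM2l m0 (ltW td).
    have : d * (l + m + 1) = z - a by rewrite /d divfK// gt_eqF.
    by move: h1 h2 d0; rewrite /a; lra.
  have [s1 Is1 [t1 Jt1 h1]] : exists2 s1, I s1 & exists2 t1, J t1 & z < l * s1 + m * t1.
    pose d := (b - z) / (l + m + 1).
    have lm : 0 < l + m + 1 by rewrite ltr_wpDl// addr_ge0.
    have d0 : 0 < d by rewrite divr_gt0// subr_gt0.
    have [s Is sd] := sup_adherent d0 sI; have [t Jt td] := sup_adherent d0 sJ.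
    exists s => //; exists t => //.
    have h1 := ler_wpM2l l0 (ltW sd); have h2 := ler_wpM2l m0 (ltW td).
    have : d * (l + m + 1) = b - z by rewrite /d divfK// gt_eqF.
    by move: h1 h2 d0; rewrite /b; lra.
  set f0 := l * s0 + m * t0 in h0; set f1 := l * s1 + m * t1 in h1.
  (* Moving with the same [theta] from [s0] to [s1] and from [t0] to [t1] carries the combination
     affinely from [f0] to [f1], hence through [z]. *)
  pose theta := (z - f0) / (f1 - f0).
  have f10 : 0 < f1 - f0 by rewrite subr_gt0 (lt_trans h0).
  have th : 0 <= theta <= 1.
    apply/andP; split; first by rewrite divr_ge0 ?(ltW f10)// subr_ge0 ltW.
    by rewrite ler_pdivrMr// mul1r lerB// ltW.
  have -> : z = l * ((1 - theta) * s0 + theta * s1) + m * ((1 - theta) * t0 + theta * t1).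
    transitivity ((1 - theta) * f0 + theta * f1); last by rewrite /f0 /f1; ring.
    by rewrite /theta; field; rewrite gt_eqF.
  by apply: IJL; [apply: cI|apply: cJ].
have : (leb [set` `]a, b[] <= leb L)%E by apply: le_measure; rewrite ?inE.
apply: le_trans.
rewrite lebesgue_measure_itv/= lte_fin; case: ifPn => //.
by rewrite lee_fin subr_le0 -leNgt.
Qed.

Lemma lebesgue_unit_below (e : \bar R) : (0 <= e)%E ->
  leb [set c | (0 < c < 1) && (c%:E < e)%E] = mine e 1%E.
Proof.
move=> e0; have [r01|h1] := ltP e 1%E.
  case: e e0 r01 => [r| |] //; rewrite lee_fin lte_fin => r0 r1.
  have -> : [set c | (0 < c < 1) && (c%:E < r%:E)%E] = [set` `]0%R, r[].
    apply/seteqP; split => c; rewrite /= lte_fin in_itv/=.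
      by move=> /andP[/andP[-> _] ->].
    by move=> /andP[-> cr]; rewrite cr !andbT/= (lt_trans cr).
  rewrite lebesgue_measure_itv/= lte_fin; case: ltgtP r0 => // [_|<-] _.
    by rewrite oppr0 adde0.
  by [].
have -> : [set c | (0 < c < 1) && (c%:E < e)%E] = [set` `]0%R, 1%R[].
  apply/seteqP; split => c; rewrite /= in_itv/=.
    by move=> /andP[].
  by move=> /andP[-> c1]; rewrite c1/= (lt_le_trans _ h1)// lte_fin.
by rewrite lebesgue_measure_itv/= lte_fin ltr01 oppr0 adde0.
Qed.

(** Tonelli for the region under the graph of [psi] and below height 1. The truncation matches
    functions of supremum 1; [psi] itself may exceed 1 or be infinite. *)
Lemma layer_cake psi : measurable_fun setT psi -> (forall t, (0 <= psi t)%E) ->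
  (\int[leb]_t mine (psi t) 1 =
   \int[leb]_(c in `]0%R, 1%R[) leb [set t | c%:E < psi t])%E.
Proof.
move=> mpsi psi0.
pose E := [set tc : R * R | (0 < tc.2 < 1) && (tc.2%:E < psi tc.1)%E].
have mE : measurable E.
  have -> : E = (setT `*` [set` `]0%R, 1%R[]) `&` [set tc | (tc.2%:E < psi tc.1)%E].
    apply/seteqP; split => -[t c]; rewrite /E /= in_itv/=.
      by move=> /andP[h1 h2].
    by move=> [[_ ->] ->].
  apply: measurable_lte; first exact: measurableX.
    by apply/measurable_funTS/measurable_EFinP.
  by apply/measurable_funTS; exact: (measurableT_comp mpsi measurable_fst).
have mI : measurable_fun setT (EFin \o \1_E : R * R -> \bar R).
  by apply/measurable_EFinP; exact: measurable_indic.
have := @fubini_tonelli _ _ _ _ R leb leb (EFin \o \1_E) mI.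
have i0 : forall x : R * R, (0 <= (EFin \o \1_E : R * R -> \bar R) x)%E.
  by move=> x; rewrite /= lee_fin.
move=> /(_ i0) H; clear i0 mI.
transitivity (\int[leb]_x \int[leb]_y (EFin \o \1_E) (x, y))%E.
  apply: eq_integral => t _.
  have -> : (fun y => (EFin \o \1_E) (t, y)) = EFin \o \1_(xsection E t) :> (R -> \bar R).
    by apply/funext => c /=; rewrite !indicE mem_xsection.
  have mx := measurable_xsection t mE.
  rewrite integral_indic; [|exact: measurableT|exact: mx].
  rewrite setIT.
  rewrite -(lebesgue_unit_below (psi0 t)); congr (leb _).
  by apply/seteqP; split => c; rewrite /xsection /= inE.
rewrite {}H [RHS]integral_mkcond; apply: eq_integral => c _.
rewrite patchE.
have -> : (fun x => (EFin \o \1_E) (x, c)) = EFin \o \1_(ysection E c) :> (R -> \bar R).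
  by apply/funext => x /=; rewrite !indicE mem_ysection.
have my := measurable_ysection c mE.
rewrite integral_indic; [|exact: measurableT|exact: my].
rewrite setIT; case: ifPn.
  rewrite inE /= in_itv/= => c01; congr (leb _).
  by apply/seteqP; split => x; rewrite /ysection /= inE /E /= c01.
move=> cn; have -> : ysection E c = set0; last exact: measure0.
rewrite -subset0 => x; rewrite /ysection /= inE /E /= => /andP[h _].
by move: cn; rewrite notin_setE /= in_itv/= h.
Qed.

(** For each level [c] in ]0, 1[ the set [psi > c] contains the combination of the sets [phi1 > c]
    and [phi2 > c], which are nonempty intervals; the interval inequality is then integrated over
    [c]. *)
Lemma lebesgue_functional_sum (phi1 phi2 : R -> R) psi (l m M : R) :
  0 <= l -> 0 <= m ->
  (forall phi, phi = phi1 \/ phi = phi2 ->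
   [/\ measurable_fun setT phi, forall t, 0 <= phi t <= 1 &
    forall c, 0 < c < 1 -> [/\ [set t | c < phi t] !=set0,
      segment_closed [set t | c < phi t] &
      forall t, c < phi t -> `|t| <= M]]) ->
  measurable_fun setT psi -> (forall t, (0 <= psi t)%E) ->
  (forall s t, 0 < phi1 s -> 0 < phi2 t ->
    ((Num.min (phi1 s) (phi2 t))%:E <= psi (l * s + m * t)%R)%E) ->
  (l%:E * \int[leb]_t (phi1 t)%:E + m%:E * \int[leb]_t (phi2 t)%:E <=
   \int[leb]_t psi t)%E.
Proof.
move=> l0 m0 hphi mpsi psi0 H.
have layer phi : phi = phi1 \/ phi = phi2 ->
    (\int[leb]_t (phi t)%:E =
    \int[leb]_(c in `]0%R, 1%R[) leb [set t | c < phi t]%R)%E.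
  move=> /hphi[mphi phi01 _].
  rewrite -(@layer_cake (EFin \o phi)).
  - apply: eq_integral => t _ /=; rewrite /mine lte_fin.
    by case: ltgtP (phi01 t) => // [|->]; rewrite ?andbF.
  - exact/measurable_EFinP.
  - by move=> t; rewrite /= lee_fin; case/andP: (phi01 t).
have mlevel g : measurable_fun setT g -> measurable_fun (setT : set R)
    (fun c : R => leb [set t | (c%:E < g t)%E]).
  move=> mg.
  pose E := [set tc : R * R | (tc.2%:E < g tc.1)%E].
  have mE : measurable E.
    rewrite -[E]setTI; apply: measurable_lte => //.
      exact/measurable_EFinP.
    exact: (measurableT_comp mg measurable_fst).
  have := @measurable_fun_ysection _ _ _ _ _ leb _ mE.
  congr measurable_fun; apply/funext => c /=; congr (leb _).
  by apply/seteqP; split => x; rewrite /ysection /= inE.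
apply: (@le_trans _ _ (\int[leb]_t mine (psi t) 1)%E); last first.
  apply: ge0_le_integral => //.
  - by move=> t _; rewrite le_min psi0 lee_fin ler01.
  - exact: measurable_mine.
  - by move=> t _; rewrite ge_min lexx.
have [m1 p1 L1] := hphi _ (or_introl erefl).
have [m2 p2 L2] := hphi _ (or_intror erefl).
rewrite layer_cake// (layer phi1 (or_introl erefl)) (layer phi2 (or_intror erefl)).
have mle phi : measurable_fun setT phi ->
    measurable_fun ([set` `]0%R, 1%R[] : set R) (fun c : R => leb [set t | c < phi t]).
  move=> mphi; apply: measurable_funTS; apply: (mlevel (EFin \o phi)).
  exact/measurable_EFinP.
rewrite -!ge0_integralZl//; [|exact: mle|exact: mle].
rewrite -ge0_integralD//; last 4 first.
- by move=> c _; rewrite mule_ge0// lee_fin.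
- exact: measurable_funeM (mle _ m1).
- by move=> c _; rewrite mule_ge0// lee_fin.
- exact: measurable_funeM (mle _ m2).
apply: ge0_le_integral => //.
- by move=> c _; rewrite adde_ge0// mule_ge0// lee_fin.
- by apply: emeasurable_funD; [exact: measurable_funeM (mle _ m1)|exact: measurable_funeM (mle _ m2)].
- by apply: measurable_funTS; exact: mlevel.
move=> c /=; rewrite in_itv/= => c01.
have [I0 cI bI] := L1 _ c01; have [J0 cJ bJ] := L2 _ c01.
apply: (@lebesgue_interval_sum _ _ _ l m M) => //.
  by rewrite -[X in measurable X]setTI; apply: emeasurable_fun_o_infty.
move=> s t /= cs ct; case/andP: c01 => c0 c1.
apply: lt_le_trans (H s t (lt_trans c0 cs) (lt_trans c0 ct)).
by rewrite lte_fin lt_min cs.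
Qed.

End one_dimensional_brunn_minkowski.

(** * The Brunn-Minkowski inequality for convex sets *)

Section brunn_minkowski.
Variable R : realType.
Local Notation leb := (@lebesgue_measure R).

Definition slice n (A : set 'rV[R]_n.+1) (t : R) : set 'rV[R]_n :=
  [set v | A (rV_cons (t, v))].

Lemma rV_consK n (x : 'rV[R]_n.+1) :
  rV_cons (x ord0 (lshift n ord0 : 'I_(1 + n)), \row_j x ord0 (rshift 1 j : 'I_(1 + n))) = x.
Proof.
apply/rowP => j; case: (@split_ordP 1 n j) => i ->.
  by rewrite rV_cons0 /= (ord1 i).
by rewrite rV_consS /= mxE.
Qed.

Lemma rV_cons_lin n (l m s t : R) (v w : 'rV[R]_n) :
  l *: rV_cons (s, v) + m *: rV_cons (t, w) =
  rV_cons (l * s + m * t, l *: v + m *: w).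
Proof.
apply/rowP => j; case: (@split_ordP 1 n j) => i ->.
  by rewrite [LHS]mxE [X in X + _]mxE [X in _ + X]mxE !rV_cons0.
by rewrite [LHS]mxE [X in X + _]mxE [X in _ + X]mxE !rV_consS /= !mxE.
Qed.

Lemma measurable_slice n (A : set 'rV[R]_n.+1) t :
  measurable (A : set (borel R n.+1)) -> measurable (slice A t : set (borel R n)).
Proof.
move=> mA; have := @measurable_rV_cons R n measurableT _ mA.
rewrite setTI => /(measurable_xsection t).
congr measurable; apply/seteqP; split => v; rewrite /xsection /= inE //.
Qed.

Lemma lebesgue_rVS n (A : set 'rV[R]_n.+1) :
  lebesgue_rV (A : set (borel R n.+1)) = (\int[leb]_t lebesgue_rV (slice A t : set (borel R n)))%E.
Proof.
rewrite /= /pushforward /product_measure1; apply: eq_integral => t _ /=.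
congr (lebesgue_rV _); apply/seteqP; split => v; rewrite /xsection /= inE //.
Qed.

Lemma measurable_lebesgue_slice n (A : set 'rV[R]_n.+1) :
  measurable (A : set (borel R n.+1)) ->
  measurable_fun [set: R] (fun t => lebesgue_rV (slice A t : set (borel R n))).
Proof.
move=> mA; have := @measurable_rV_cons R n measurableT _ mA; rewrite setTI => mA'.
have := @measurable_fun_xsection _ _ _ _ _ (@lebesgue_rV R n) _ mA'.
congr measurable_fun; apply/funext => t /=.
by congr (lebesgue_rV _); apply/seteqP; split => v; rewrite /xsection /= inE.
Qed.

(** The dimension is given by an equation so that the lemma also applies to slices of a variable
    dimension [p] in the branch [p = 0]. *)
Lemma lebesgue_rV_dim0 n (A : set 'rV[R]_n) : n = 0%N ->
  (lebesgue_rV (A : set (borel R n)) <= 1)%E /\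
  (A !=set0 -> lebesgue_rV (A : set (borel R n)) = 1%E).
Proof.
case: n A => // A _; split; rewrite /= diracE.
  by case: (_ \in _); rewrite lee_fin ?ler01.
by move=> [x Ax]; rewrite mem_set// -(thinmx0 x).
Qed.

(** The bound [M] is explicit because all slices inherit the same one. *)
Definition entries_bounded n (M : R) (A : set 'rV[R]_n) := forall x, A x -> forall i, `|x ord0 i| <= M.

Lemma lebesgue_rV_bounded n (M : R) : exists B : R, forall A : set 'rV[R]_n,
  measurable (A : set (borel R n)) -> entries_bounded M A ->
  (lebesgue_rV (A : set (borel R n)) <= B%:E)%E.
Proof.
have [mu muE mufin] := lebesgue_rV_spec R n.
have Mk : M < (Num.bound `|M|).+1%:R.
  by rewrite (le_lt_trans (ler_norm M))// (lt_le_trans (archi_boundP (normr_ge0 M)))// ler_nat.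
move: Mk (mufin (Num.bound `|M|)); rewrite muE; move: (Num.bound `|M|) => k Mk fink.
exists (fine (lebesgue_rV (ball (0 : 'rV[R]_n) k.+1%:R : set (borel R n)))) => A mA bA.
rewrite fineK ?ge0_fin_numE//; apply: le_measure; rewrite ?inE//.
  by apply: sub_sigma_algebra; exact: ball_open.
move=> x /bA xM; split => // i j.
by rewrite ord1 /ball /= mxE sub0r normrN (le_lt_trans (xM j)).
Qed.

Lemma lebesgue_rV_lty n (M : R) (A : set 'rV[R]_n) :
  measurable (A : set (borel R n)) -> entries_bounded M A ->
  (lebesgue_rV (A : set (borel R n)) < +oo)%E.
Proof.
move=> mA bA; have [B HB] := lebesgue_rV_bounded n M.
by rewrite (le_lt_trans (HB A mA bA))// ltry.
Qed.

Lemma slice_bounded n (M : R) (A : set 'rV[R]_n.+1) t :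
  entries_bounded M A -> entries_bounded M (slice A t).
Proof.
move=> bA v /bA /= vM i; have := vM (rshift 1 i : 'I_(1 + n)).
by rewrite rV_consS.
Qed.

Lemma slice_nonempty_le n (M : R) (A : set 'rV[R]_n.+1) t :
  entries_bounded M A -> slice A t !=set0 -> `|t| <= M.
Proof.
move=> bA [v /bA /= vM]; have := vM (lshift n ord0 : 'I_(1 + n)).
by rewrite rV_cons0.
Qed.

Definition convex_rV n (A : set 'rV[R]_n) :=
  forall x y (theta : R), A x -> A y -> 0 <= theta <= 1 ->
    A ((1 - theta) *: x + theta *: y).

Lemma convex_rV_slice n (A : set 'rV[R]_n.+1) t : convex_rV A -> convex_rV (slice A t).
Proof.
move=> cA v w th Av Aw th01; have := cA _ _ _ Av Aw th01.
by rewrite rV_cons_lin /slice /= -mulrDl subrK mul1r.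
Qed.

Lemma exists_root p (c : R) : 0 <= c -> (0 < p)%N -> exists2 a, 0 <= a & a ^+ p = c.
Proof.
move=> c0 p0; exists (c `^ (p%:R^-1)); first exact: powR_ge0.
by rewrite -powR_mulrn ?powR_ge0// -powRrM mulVf ?powRr1// pnatr_eq0 -lt0n.
Qed.

(** The roots of the volumes enter as lower bounds [a], [b], which avoids extracting roots and makes
    sense for [n = 0]. [C] is any measurable set containing the Minkowski combination. *)
Definition brunn_minkowski_at n := forall (A B C : set 'rV[R]_n) (M l m a b : R),
  measurable (A : set (borel R n)) -> measurable (B : set (borel R n)) ->
  measurable (C : set (borel R n)) ->
  convex_rV A -> convex_rV B -> entries_bounded M A -> entries_bounded M B ->
  A !=set0 -> B !=set0 ->
  0 <= l -> 0 <= m -> (forall x y, A x -> B y -> C (l *: x + m *: y)) ->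
  0 <= a -> 0 <= b ->
  ((a ^+ n)%:E <= lebesgue_rV (A : set (borel R n)))%E ->
  ((b ^+ n)%:E <= lebesgue_rV (B : set (borel R n)))%E ->
  (((l * a + m * b) ^+ n)%:E <= lebesgue_rV (C : set (borel R n)))%E.

(** In positive dimension [c] is an [n]-th power and is absorbed into [a] and [b]. In dimension 0
    there is no such root, but a nonempty set has volume 1, so [c <= 1] is enough. *)
Lemma brunn_minkowski_scaled n : brunn_minkowski_at n ->
  forall (A B C : set 'rV[R]_n) (M l m a b c : R),
  measurable (A : set (borel R n)) -> measurable (B : set (borel R n)) ->
  measurable (C : set (borel R n)) ->
  convex_rV A -> convex_rV B -> entries_bounded M A -> entries_bounded M B ->
  A !=set0 -> B !=set0 ->
  0 <= l -> 0 <= m -> (forall x y, A x -> B y -> C (l *: x + m *: y)) ->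
  0 <= a -> 0 <= b -> 0 <= c <= 1 ->
  ((c * a ^+ n)%:E <= lebesgue_rV (A : set (borel R n)))%E ->
  ((c * b ^+ n)%:E <= lebesgue_rV (B : set (borel R n)))%E ->
  ((c * (l * a + m * b) ^+ n)%:E <= lebesgue_rV (C : set (borel R n)))%E.
Proof.
move=> BM A B C M l m a b c mA mB mC cA cB bA bB A0 B0 l0 m0 ABC a0 b0 /andP[c0 c1].
case: n BM A B C mA mB mC cA cB bA bB A0 B0 ABC =>
    [|n] BM A B C mA mB mC cA cB bA bB A0 B0 ABC.
  move=> _ _; rewrite expr0 mulr1 (lebesgue_rV_dim0 C erefl).2 ?lee_fin//.
  by have [x Ax] := A0; have [y By] := B0; exists (l *: x + m *: y); exact: ABC.
have [g g0 gc] := exists_root c0 (ltn0Sn n).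
rewrite -gc -!exprMn => hA hB.
have -> : g * (l * a + m * b) = l * (g * a) + m * (g * b) by ring.
by apply: (BM A B C M) => //; exact: mulr_ge0.
Qed.

End brunn_minkowski.

Section brunn_minkowski_induction.
Variable R : realType.
Local Notation leb := (@lebesgue_measure R).

(* [phi] is [t |-> |A_t|] divided by its supremum [a ^+ p], or the indicator of
   one point when all slices [A_t] are null *)
Lemma normalized_slices p (A : set 'rV[R]_p.+1) (M alpha : R) :
  brunn_minkowski_at R p ->
  measurable (A : set (borel R p.+1)) -> convex_rV A -> entries_bounded M A ->
  A !=set0 -> 0 <= alpha ->
  ((alpha ^+ p.+1)%:E <= lebesgue_rV (A : set (borel R p.+1)))%E ->
  exists a x, exists phi : R -> R,
    [/\ [/\ 0 <= a, 0 <= x & alpha = a * x],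
     [/\ measurable_fun setT phi, forall t, 0 <= phi t <= 1 &
      forall c, 0 < c < 1 -> [/\ [set t | c < phi t] !=set0,
      segment_closed [set t | c < phi t] &
      forall t, c < phi t -> `|t| <= M]],
      ((a * x ^+ p.+1)%:E <= \int[leb]_t (phi t)%:E)%E &
      forall t, 0 < phi t -> slice A t !=set0 /\
        ((phi t * a ^+ p)%:E <= lebesgue_rV (slice A t : set (borel R p)))%E].
Proof.
move=> BM mA cA bA A0 alpha0 alphaA.
pose F t := fine (lebesgue_rV (slice A t : set (borel R p))).
have FE t : (F t)%:E = lebesgue_rV (slice A t : set (borel R p)).
  rewrite fineK// ge0_fin_numE//.
  by apply: (@lebesgue_rV_lty _ _ M); [exact: measurable_slice|exact: slice_bounded].
have F0 t : 0 <= F t by rewrite fine_ge0.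
have mF : measurable_fun setT F.
  apply: measurableT_comp; first exact: fine_measurable.
  exact: measurable_lebesgue_slice.
have AF : lebesgue_rV (A : set (borel R p.+1)) = (\int[leb]_t (F t)%:E)%E.
  by rewrite lebesgue_rVS; apply: eq_integral => t _; rewrite FE.
have [B HB] := lebesgue_rV_bounded p M.
have FB t : F t <= B.
  by rewrite -lee_fin FE; apply: HB; [exact: measurable_slice|exact: slice_bounded].
have hS : has_sup (range F).
  by split; [exists (F 0); exists 0|exists B => _ [t _ <-]].
have [s0 As0] : exists s, slice A s !=set0.
  have [z Az] := A0; exists (z ord0 (lshift p ord0 : 'I_(1 + p))).
  by exists (\row_j z ord0 (rshift 1 j : 'I_(1 + p))); rewrite /slice /= rV_consK.
set S := sup (range F).
have FS t : F t <= S by apply: ub_le_sup; [case: hS|exists t].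
have Fne t : 0 < F t -> slice A t !=set0.
  move=> Ft; apply/set0P/eqP => E; move: Ft.
  by rewrite /F E measure0 ltxx.
(* For [p = 0] the equation [a ^+ p = S] is solvable only if [S = 1]. *)
have S1 : p = 0%N -> S = 1.
  move=> p0; apply: le_anti; apply/andP; split.
    apply: sup_le_ub; first by case: hS.
    move=> _ [t _ <-]; rewrite -lee_fin FE.
    exact: (lebesgue_rV_dim0 (slice A t) p0).1.
  apply: le_trans (FS s0); rewrite -lee_fin FE.
  by rewrite (lebesgue_rV_dim0 (slice A s0) p0).2.
have [S0|S_le0] := ltP 0 S.
  have [a a0 aS] : exists2 a, 0 < a & a ^+ p = S.
    have [p0|p0] := posnP p; first by exists 1 => //; rewrite p0 S1.
    have [a a0 aS] := exists_root (ltW S0) p0; exists a => //.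
    rewrite lt_neqAle a0 andbT; apply/eqP => a00.
    by move: S0; rewrite -aS -a00 expr0n gtn_eqF// ltxx.
  (* With this [x], [a * x ^+ p.+1] is [alpha ^+ p.+1 / S], and the integral of [F / S] is the
     volume of [A] divided by [S]. *)
  exists a, (alpha / a), (fun t => F t / S); split.
  - by split; [exact: ltW|rewrite divr_ge0// ltW|rewrite mulrC divfK// gt_eqF].
  - split.
    + exact: measurable_funM.
    + by move=> t; rewrite divr_ge0 ?(ltW S0)//= ler_pdivrMr// mul1r.
    + move=> c /andP[c0 c1]; split.
      * have e0 : 0 < (1 - c) * S by rewrite mulr_gt0// subr_gt0.
        have [_ [t _ <-] ht] := sup_adherent e0 hS.
        exists t => /=; rewrite ltr_pdivlMr//; move: ht.
        by rewrite -/S; congr (_ < _); ring.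
      * move=> s t th /= cs ct th01.
        (* Both slices have volume at least [c' * a ^+ p], so Brunn-Minkowski in dimension [p] gives
           the same bound for the slice between them. Hence superlevel sets are convex. *)
        pose c' := Num.min (F s / S) (F t / S).
        apply: (@lt_le_trans _ _ c'); first by rewrite lt_min cs.
        have cs' : c' * S <= F s by rewrite -ler_pdivlMr// ge_min lexx.
        have ct' : c' * S <= F t by rewrite -ler_pdivlMr// ge_min lexx orbT.
        have Fs0 : 0 < F s by have := lt_trans c0 cs; rewrite pmulr_lgt0// invr_gt0.
        have Ft0 : 0 < F t by have := lt_trans c0 ct; rewrite pmulr_lgt0// invr_gt0.
        have c'0 : 0 <= c' <= 1.
          rewrite le_min !divr_ge0 ?(ltW S0)//=.
          by rewrite ge_min ler_pdivrMr// mul1r FS.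
        rewrite ler_pdivlMr// -lee_fin FE.
        have -> : S = ((1 - th) * a + th * a) ^+ p by rewrite -mulrDl subrK mul1r.
        apply: (@brunn_minkowski_scaled R p BM (slice A s) (slice A t) _ M) => //;
          try exact: measurable_slice; try exact: convex_rV_slice;
          try exact: slice_bounded; try exact: Fne; try exact: ltW.
        - by case/andP: th01; rewrite subr_ge0.
        - by case/andP: th01.
        - move=> v w Av Aw; have := cA _ _ _ Av Aw th01.
          by rewrite rV_cons_lin.
        - by rewrite -FE lee_fin aS.
        - by rewrite -FE lee_fin aS.
      * move=> t /= ct; apply: (slice_nonempty_le bA); apply: Fne.
        by have := lt_trans c0 ct; rewrite pmulr_lgt0// invr_gt0.
  - have -> : a * (alpha / a) ^+ p.+1 = S^-1 * alpha ^+ p.+1.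
      have an0 : a != 0 by rewrite gt_eqF.
      have q0 : a ^+ p != 0 by rewrite expf_neq0.
      rewrite -aS exprMn exprVn (exprSr a).
      by move: (alpha ^+ p.+1) (a ^+ p) q0 => u v q0; field; rewrite an0 q0.
    have -> : (\int[leb]_t (F t / S)%:E)%E = (S^-1%:E * \int[leb]_t (F t)%:E)%E.
      rewrite -ge0_integralZl//.
      + by apply: eq_integral => t _; rewrite mulrC EFinM.
      + exact/measurable_EFinP.
      + by move=> t _; rewrite lee_fin.
      + by rewrite lee_fin invr_ge0 ltW.
    by rewrite EFinM -AF lee_wpmul2l// lee_fin invr_ge0 ltW.
  - move=> t Ft; split; first by apply: Fne; move: Ft; rewrite pmulr_lgt0// invr_gt0.
    by rewrite -FE lee_fin aS divfK// gt_eqF.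
have SE : S = 0 by apply: le_anti; rewrite S_le0 (le_trans (F0 0)).
have Fz t : F t = 0 by apply: le_anti; rewrite F0 andbT -SE.
(* Here [alpha = 0], yet the levels of [phi] must be nonempty, so it cannot be 0; the point of any
   nonempty slice serves. The case [p = 0] is excluded since there [S = 1]. *)
exists 0, 0, (\1_[set s0]); split.
- split => //; rewrite mul0r; suff /eqP : alpha ^+ p.+1 = 0.
    by rewrite expf_eq0 /= => /eqP.
  apply: le_anti; rewrite exprn_ge0// andbT -lee_fin (le_trans alphaA)// AF.
  by rewrite integral0_eq// => t _; rewrite Fz.
- split.
  + exact: measurable_indic.
  + by move=> t; rewrite indicE; case: (_ \in _); rewrite ?lexx ?ler01.
  + have one (c t : R) : 0 < c -> c < (\1_[set s0] t : R) -> t = s0.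
      move=> c0; rewrite indicE; case: (boolP (t \in _)) => [/[!inE]//|_ /(lt_trans c0)].
      by rewrite ltxx.
    move=> c /andP[c0 c1]; split.
    * by exists s0; rewrite /= indicE mem_set.
    * move=> s t th /= /(one _ _ c0)-> /(one _ _ c0)-> _.
      by rewrite -mulrDl subrK mul1r indicE mem_set.
    * by move=> t /(one _ _ c0)->; exact: slice_nonempty_le As0.
- by rewrite mul0r; apply: integral_ge0 => t _; rewrite lee_fin.
- move=> t; rewrite indicE; case: (boolP (t \in _)) => [/[!inE] -> _|]; last by rewrite ltxx.
  split => //; rewrite mul1r expr0n -FE Fz.
  have [p0|p0] := eqVneq p 0%N; last by [].
  by move: S_le0; rewrite S1// ler10.
Qed.

(** If [c] is the minimum of [phi1 s] and [phi2 t], the slices have volumes at least [c * a ^+ p]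
    and [c * b ^+ p], so by induction the slice of [C] at [l * s + m * t] has volume at least
    [c * k]. The functional inequality applies to the slice volumes of [C] divided by [k], and the
    power mean inequality with weights [l * a], [m * b] recovers the claim. *)
Lemma brunn_minkowski_natpow n : brunn_minkowski_at R n.
Proof.
elim: n => [|p IH] A B C M l m alpha beta mA mB mC cA cB bA bB A0 B0 l0 m0 ABC al0 be0.
  by move=> _ _; rewrite expr0 (lebesgue_rV_dim0 C erefl).2//;
    have [x Ax] := A0; have [y By] := B0; exists (l *: x + m *: y); exact: ABC.
move=> /(normalized_slices IH mA cA bA A0 al0)[a [x [phi1 [[a0 x0 ->] P1 I1 H1]]]].
move=> /(normalized_slices IH mB cB bB B0 be0)[b [y [phi2 [[b0 y0 ->] P2 I2 H2]]]].
have la0 : 0 <= l * a by rewrite mulr_ge0.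
have mb0 : 0 <= m * b by rewrite mulr_ge0.
rewrite !mulrA; apply: (@le_trans _ _ ((l * a + m * b) ^+ p *
    (l * a * x ^+ p.+1 + m * b * y ^+ p.+1))%:E).
  by rewrite lee_fin power_mean_ineq.
set k := (l * a + m * b) ^+ p.
have k0 : 0 <= k by rewrite exprn_ge0// addr_ge0.
move: k0; rewrite le_eqVlt => /predU1P[<-|k0]; first by rewrite mul0r.
rewrite EFinM -lee_pdivlMl//.
pose H t := lebesgue_rV (slice C t : set (borel R p)).
have mH : measurable_fun setT H by exact: measurable_lebesgue_slice.
have -> : (k^-1%:E * lebesgue_rV (C : set (borel R p.+1)) = \int[leb]_t (k^-1%:E * H t))%E.
  by rewrite ge0_integralZl// ?lee_fin ?invr_ge0 ?(ltW k0)// lebesgue_rVS.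
apply: le_trans (@lebesgue_functional_sum R phi1 phi2 _ l m M l0 m0 _ _ _ _).
- rewrite EFinD -!mulrA !(EFinM l) !(EFinM m).
  by apply: leeD; apply: lee_wpmul2l.
- by move=> phi [->|->].
- exact: measurable_funeM.
- by move=> t; rewrite mule_ge0// lee_fin invr_ge0 ltW.
move=> s t ps pt; have [As h1] := H1 s ps; have [Bt h2] := H2 t pt.
rewrite lee_pdivlMl//.
have [_ q1 _] := P1; have [_ q2 _] := P2.
rewrite -EFinM mulrC.
apply: (@brunn_minkowski_scaled R p IH (slice A s) (slice B t) _ M) => //;
  try exact: measurable_slice; try exact: convex_rV_slice; try exact: slice_bounded.
- by move=> v w Av Bw; have := ABC _ _ Av Bw; rewrite rV_cons_lin.
- by rewrite le_min (ltW ps) (ltW pt)/= ge_min; case/andP: (q1 s) => _ ->.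
- by apply: le_trans h1; rewrite lee_fin ler_wpM2r ?exprn_ge0// ge_min lexx.
- by apply: le_trans h2; rewrite lee_fin ler_wpM2r ?exprn_ge0// ge_min lexx orbT.
Qed.

End brunn_minkowski_induction.

(** * Sublinear functions and convex bodies *)

Section sublinear_functions.
Variables (R : realType) (n : nat).
Implicit Types (h : 'rV[R]_n -> R) (x y z v xi : 'rV[R]_n).

Lemma dotC x y : dot x y = dot y x.
Proof. by apply: eq_bigr => i _; rewrite mulrC. Qed.

Lemma dotDl x y z : dot (x + y) z = dot x z + dot y z.
Proof. by rewrite -big_split; apply: eq_bigr => i _; rewrite mxE mulrDl. Qed.

Lemma dotZl a x y : dot (a *: x) y = a * dot x y.
Proof. by rewrite /dot mulr_sumr; apply: eq_bigr => i _; rewrite mxE mulrA. Qed.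

Lemma dotNl x y : dot (- x) y = - dot x y.
Proof. by rewrite -scaleN1r dotZl mulN1r. Qed.

Lemma dotBl x y z : dot (x - y) z = dot x z - dot y z.
Proof. by rewrite dotDl dotNl. Qed.

Lemma dotDr x y z : dot z (x + y) = dot z x + dot z y.
Proof. by rewrite dotC dotDl !(dotC z). Qed.

Lemma dotZr a x y : dot y (a *: x) = a * dot y x.
Proof. by rewrite dotC dotZl (dotC y). Qed.

Lemma dotNr x y : dot y (- x) = - dot y x.
Proof. by rewrite dotC dotNl (dotC y). Qed.

Lemma dot_ge0 x : 0 <= dot x x.
Proof. by apply: sumr_ge0 => i _; rewrite -expr2 sqr_ge0. Qed.

Lemma dot_gt0 x : x != 0 -> 0 < dot x x.
Proof.
move=> x0; have /existsP[i xi0] : [exists i, x ord0 i != 0].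
  apply: contraNT x0; rewrite negb_exists => /forallP x0.
  by apply/eqP/rowP => i; rewrite mxE; apply/eqP; rewrite -[_ == _]negbK.
rewrite /dot (bigD1 i)//= ltr_pwDl//.
  by rewrite -expr2 lt_neqAle sqr_ge0 eq_sym sqrf_eq0 xi0.
by apply: sumr_ge0 => j _; rewrite -expr2 sqr_ge0.
Qed.

Lemma continuous_sum (T : topologicalType) (f : 'I_n -> T -> R) (t : T) :
  (forall i, {for t, continuous (f i)}) -> {for t, continuous (fun s : T => \sum_i f i s)}.
Proof.
move=> cf; apply: (@cvg_big _ _ (fun x y : R => x + y)).
  by move=> [a b]; exact: add_continuous.
by move=> i _; exact: cf.
Qed.

Lemma dot_continuous xi : continuous (fun x => dot x xi).
Proof.
move=> x; apply: continuous_sum => i.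
by apply: continuousM; [exact: coord_continuous|exact: cst_continuous].
Qed.

Lemma dot_sub_continuous z : continuous (fun x => dot (x - z) (x - z)).
Proof.
move=> x; apply: continuous_sum => i.
suff ci : {for x, continuous (fun y : 'rV[R]_n => (y - z) ord0 i)} by exact: continuousM.
have -> : (fun y : 'rV[R]_n => (y - z) ord0 i) = (fun y => y ord0 i - z ord0 i).
  by apply/funext => y; rewrite !mxE.
by apply: continuousB; [exact: coord_continuous|exact: cst_continuous].
Qed.

Definition sublinear h :=
  (forall x y, h (x + y) <= h x + h y) /\
  (forall a x, 0 <= a -> h (a *: x) = a * h x).

Lemma sublinear0 h : sublinear h -> h 0 = 0.
Proof. by move=> [_ hZ]; rewrite -(scale0r (0 : 'rV[R]_n)) hZ// mul0r. Qed.

Lemma sublinear_oppr h x : sublinear h -> - h x <= h (- x).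
Proof.
by move=> sh; rewrite -subr_ge0 opprK addrC -(sublinear0 sh) -[X in h X](subrr x) sh.1.
Qed.

(** One Hahn-Banach step: [h'] is the infimum over [t >= 0] of [h (x + t *: v) - t * h v].
    Subadditivity bounds it below by [- h (- x)], and [t = 1] gives the value at [- v]. *)
Lemma sublinear_linearize h v : sublinear h ->
  exists h', [/\ sublinear h', forall x, h' x <= h x & h' (- v) <= - h v].
Proof.
move=> sh; have [hD hZ] := sh.
pose E x := [set h (x + t *: v) - t * h v | t in [set t | 0 <= t]].
have E0 x : E x !=set0.
  by exists (h (x + 0 *: v) - 0 * h v), 0 => /=.
have lE x : lbound (E x) (- h (- x)).
  move=> _ [t /= t0 <-]; rewrite lerBrDr -(hZ t v t0).
  by rewrite addrC lerBlDr; have := hD (x + t *: v) (- x); rewrite addrAC subrr add0r.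
have hE x : has_lbound (E x) by exists (- h (- x)).
pose h' x := inf (E x).
have h'_le x t : 0 <= t -> h' x <= h (x + t *: v) - t * h v.
  by move=> t0; apply: ge_inf => //; exists t.
have h'Z_le a x : 0 < a -> h' (a *: x) <= a * h' x.
  move=> a0; rewrite -ler_pdivrMl//; apply: lb_le_inf => // _ [t /= t0 <-].
  rewrite ler_pdivrMl//; apply: le_trans (h'_le _ (a * t) _) _.
    by rewrite mulr_ge0// ltW.
  by rewrite -scalerA -scalerDr hZ ?(ltW a0)// mulrBr mulrA.
exists h'; split; first split.
- move=> x y; rewrite -lerBlDr; apply: lb_le_inf => // _ [s /= s0 <-].
  rewrite lerBlDr [leRHS]addrC -lerBlDr; apply: lb_le_inf => // _ [t /= t0 <-].
  rewrite lerBlDr; apply: le_trans (h'_le _ (s + t) (addr_ge0 s0 t0)) _.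
  rewrite scalerDl addrACA; have := hD (x + s *: v) (y + t *: v); lra.
- move=> a x; rewrite le_eqVlt => /predU1P[<-|a0].
    rewrite scale0r mul0r; apply: le_anti; apply/andP; split.
      by apply: le_trans (h'_le 0 0 _) _ => //; rewrite scale0r addr0 (sublinear0 sh) mul0r subrr.
    by have := lb_le_inf (E0 0) (lE 0); rewrite oppr0 (sublinear0 sh) oppr0.
  apply: le_anti; rewrite h'Z_le//=.
  have := h'Z_le a^-1 (a *: x); rewrite invr_gt0 => /(_ a0).
  by rewrite scalerA mulVf ?gt_eqF// scale1r ler_pdivlMl.
- by move=> x; have := h'_le x 0 (lexx 0); rewrite scale0r addr0 mul0r subr0.
- have := h'_le (- v) 1 ler01.
  by rewrite scale1r addNr (sublinear0 sh) mul1r sub0r.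
Qed.

(** Linearity along a direction survives passing to a smaller sublinear function, since
    [h2 (- w) <= h1 (- w) <= - h1 w <= - h2 w]. Finitely many steps therefore treat a whole
    basis. *)
Lemma sublinear_linearize_seq h (s : seq 'rV[R]_n) : sublinear h ->
  exists h', [/\ sublinear h', forall x, h' x <= h x &
    forall v, v \in s -> h' (- v) = - h' v].
Proof.
move=> sh; elim: s => [|v s [h1 [sh1 h1h h1s]]]; first by exists h.
have [h2 [sh2 h21 h2v]] := sublinear_linearize v sh1.
have key w : h1 (- w) <= - h1 w -> h2 (- w) = - h2 w.
  move=> hw; apply: le_anti; rewrite sublinear_oppr// andbT.
  have := h21 (- w); have := h21 w; lra.
exists h2; split => //; first by move=> x; exact: le_trans (h21 x) (h1h x).
move=> w; rewrite inE => /predU1P[->|ws]; last by apply: key; rewrite h1s.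
apply: le_anti; rewrite sublinear_oppr// andbT.
by apply: le_trans h2v _; rewrite lerN2.
Qed.

Lemma dot_unit z i : dot z (unit_vector R i) = z ord0 i.
Proof.
rewrite /dot (bigD1 i)//= big1 ?addr0 => [|j ji]; first by rewrite mxE !eqxx mulr1.
by rewrite mxE (negbTE ji) andbF mulr0.
Qed.

Lemma rV_sum_unit x : x = \sum_i x ord0 i *: unit_vector R i.
Proof. exact: row_sum_delta. Qed.

Lemma sublinear_sum h (I : Type) (s : seq I) (F : I -> 'rV[R]_n) : sublinear h ->
  h (\sum_(i <- s) F i) <= \sum_(i <- s) h (F i).
Proof.
move=> sh; elim/big_rec2 : _ => [|i y1 y2 _ H]; first by rewrite sublinear0.
by apply: le_trans (sh.1 _ _) _; rewrite lerD2l.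
Qed.

(** The Wulff shape of [h]: an explicit description of the body that [body_of_support] only chooses,
    with inclusions and monotonicity immediate. *)
Definition wulff_body h := [set z | forall xi, dot z xi <= h xi].

(** Linearizing along [xi] first and then along the basis leaves a linear functional [dot z] below
    [h]; the first step gives [dot z (- xi) <= - h xi], which forces equality at [xi]. *)
Lemma wulff_body_support h xi : sublinear h ->
  exists2 z, wulff_body h z & dot z xi = h xi.
Proof.
move=> sh; have [h1 [sh1 h1h h1xi]] := sublinear_linearize xi sh.
have [h2 [sh2 h21 h2l]] := sublinear_linearize_seq [seq unit_vector R i | i <- enum 'I_n] sh1.
have h2Z a i : h2 (a *: unit_vector R i) = a * h2 (unit_vector R i).
  have [a0|a0] := leP 0 a; first exact: sh2.2.
  rewrite -[in LHS](opprK a) scaleNr -scalerN sh2.2 ?oppr_ge0 ?ltW//.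
  by rewrite h2l ?mulrNN// map_f// mem_enum.
pose z : 'rV[R]_n := \row_i h2 (unit_vector R i).
have h2z x : h2 x <= dot z x.
  rewrite [X in h2 X](rV_sum_unit x); apply: le_trans (sublinear_sum _ _ sh2) _.
  by apply: ler_sum => i _; rewrite h2Z mxE mulrC.
have zh2 x : dot z x <= h2 x.
  have := h2z (- x); have := sublinear_oppr x sh2; rewrite dotNr; lra.
have zK : wulff_body h z.
  by move=> x; exact: le_trans (zh2 x) (le_trans (h21 x) (h1h x)).
exists z => //; apply: le_anti; rewrite zK/=.
by have := le_trans (zh2 (- xi)) (le_trans (h21 _) h1xi); rewrite dotNr lerN2.
Qed.

Lemma wulff_body_nonempty h : sublinear h -> wulff_body h !=set0.
Proof. by move=> /(wulff_body_support 0)[z Kz _]; exists z. Qed.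

Lemma wulff_body_bounded h : exists M, entries_bounded M (wulff_body h).
Proof.
exists (\sum_i (`|h (unit_vector R i)| + `|h (- unit_vector R i)|)) => z Kz i.
apply: (@le_trans _ _ (`|h (unit_vector R i)| + `|h (- unit_vector R i)|)).
  have := Kz (unit_vector R i); have := Kz (- unit_vector R i); rewrite dotNr dot_unit.
  have := ler_norm (h (unit_vector R i)); have := ler_norm (h (- unit_vector R i)).
  have := normr_ge0 (h (unit_vector R i)); have := normr_ge0 (h (- unit_vector R i)).
  by move=> *; rewrite ler_norml; apply/andP; split; lra.
rewrite (bigD1 i)//= lerDl; apply: sumr_ge0 => j _; exact: addr_ge0.
Qed.

Lemma wulff_body_closed h : closed (wulff_body h).
Proof.
have -> : wulff_body h = \bigcap_xi ((fun z => dot z xi) @^-1` [set t | t <= h xi]).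
  by apply/seteqP; split => z /= Kz xi; [move=> _; exact: Kz|exact: Kz].
apply: closed_bigI => xi _; apply: closed_comp => [z _|]; last exact: closed_le.
exact: dot_continuous.
Qed.

Lemma wulff_body_convex h : convex_rV (wulff_body h).
Proof.
move=> x y th Kx Ky /andP[t0 t1] xi; rewrite dotDl !dotZl.
have h1 : (1 - th) * dot x xi <= (1 - th) * h xi by rewrite ler_wpM2l// subr_ge0.
have h2 : th * dot y xi <= th * h xi by rewrite ler_wpM2l.
by apply: le_trans (lerD h1 h2) _; rewrite -mulrDl subrK mul1r.
Qed.

Lemma bounded_entries_compact M (A : set 'rV[R]_n) :
  entries_bounded M A -> closed A -> compact A.
Proof.
move=> bM; apply: bounded_closed_compact.
exists (Num.max 0 M); split; first exact: num_real.
move=> K; rewrite gt_max => /andP[K0 MK] x /bM xM.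
rewrite /= ltW// -[x]subr0.
have : ball x K 0; last by rewrite mx_norm_ball.
split => // i j.
by rewrite ord1 /ball /= mxE subr0 (le_lt_trans (xM j)).
Qed.

Lemma wulff_body_compact h : compact (wulff_body h).
Proof.
have [M bM] := wulff_body_bounded h.
by apply: (bounded_entries_compact bM); exact: wulff_body_closed.
Qed.

Lemma closed_borel (A : set 'rV[R]_n) : closed A -> measurable (A : set (borel R n)).
Proof.
move=> cA; rewrite -[A]setCK; apply: measurableC; apply: sub_sigma_algebra.
exact: closed_openC.
Qed.

Lemma measurable_wulff_body h : measurable (wulff_body h : set (borel R n)).
Proof. by apply: closed_borel; exact: wulff_body_closed. Qed.

Lemma wulff_body_convex_body h : sublinear h -> convex_body (wulff_body h).
Proof.
move=> sh; split; [exact: wulff_body_nonempty|exact: wulff_body_compact|].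
move=> x y k; rewrite !inE => Kx Ky.
have := @wulff_body_convex h y x k%:num Ky Kx.
rewrite addrC; apply; by rewrite ge0 le1.
Qed.

Lemma support_function_wulff h : sublinear h -> support_function (wulff_body h) = h.
Proof.
move=> sh; apply/funext => xi; apply: le_anti; apply/andP; split.
  apply: ge_sup; last by move=> _ [z Kz <-].
  by have [z Kz] := wulff_body_nonempty sh; exists (dot z xi), z.
have [z Kz <-] := wulff_body_support xi sh.
by apply: ub_le_sup; [exists (h xi) => _ [w Kw <-]|exists z].
Qed.

Lemma dot_le_support (A : set 'rV[R]_n) z xi : compact A -> A z ->
  dot z xi <= support_function A xi.
Proof.
move=> cA Az; apply: ub_le_sup; last by exists z.
have [||c _ cM] := @EVT_max_rV R n (fun x => dot x xi) A _ cA.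
- by exists z.
- exact/continuous_subspaceT/dot_continuous.
by exists (dot c xi) => _ [w Aw <-]; apply: cM; rewrite inE.
Qed.

Lemma support_function_sublinear (A : set 'rV[R]_n) : convex_body A ->
  sublinear (support_function A).
Proof.
move=> [[a Aa] cA _].
have ne xi : [set dot z xi | z in A] !=set0 by exists (dot a xi), a.
split=> [x y|k x k0].
  apply: ge_sup => // _ [z Az <-]; rewrite dotDr.
  by apply: lerD; exact: dot_le_support.
move: k0; rewrite le_eqVlt => /predU1P[<-|k0].
  rewrite scale0r mul0r /support_function.
  rewrite (_ : [set _ | _ in _] = [set 0]) ?sup1//.
  apply/seteqP; split => [_ [z _ <-]|_ ->] /=; first by rewrite -(scale0r x) dotZr mul0r.
  by exists a => //; rewrite -(scale0r x) dotZr mul0r.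
apply: le_anti; apply/andP; split.
  by apply: ge_sup => // _ [z Az <-]; rewrite dotZr ler_pM2l//; exact: dot_le_support.
rewrite -ler_pdivlMl//; apply: ge_sup => // _ [z Az <-].
by rewrite ler_pdivlMl// -dotZr; exact: dot_le_support.
Qed.

(** Separation: if [z] is outside [A] and [p] is its nearest point in [A], the direction [z - p]
    violates the inequality defining the Wulff body. *)
Lemma convex_body_wulff (A : set 'rV[R]_n) : convex_body A ->
  wulff_body (support_function A) = A.
Proof.
move=> [A0 cA vA]; apply/seteqP; split => z; last first.
  by move=> Az xi; exact: dot_le_support.
move=> Kz; apply: contrapT => nAz.
pose f (a : 'rV[R]_n) := dot (a - z) (a - z).
have cf : continuous f by exact: dot_sub_continuous.
have [|p] := @EVT_min_rV R n f A A0 cA.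
  exact/continuous_subspaceT.
rewrite inE => Ap pmin.
have pz : z - p != 0.
  by apply/eqP => /eqP; rewrite subr_eq0 => /eqP zp; apply: nAz; rewrite zp.
have far a : A a -> dot a (z - p) <= dot p (z - p).
  move=> Aa; rewrite leNgt; apply/negP => pa.
  pose d := a - p.
  have dzp : 0 < dot d (z - p) by rewrite dotBl subr_gt0.
  have dd : 0 < dot d d + 1 by rewrite ltr_wpDl// dot_ge0.
  (* Going from [p] to [p + t *: d] changes the squared distance to [z] by
     [t * (t * dot d d - 2 * dot d (z - p))], which is negative for this [t]; that contradicts the
     choice of [p]. *)
  pose t := Num.min 1 (dot d (z - p) / (dot d d + 1)).
  have t0 : 0 < t by rewrite lt_min ltr01 divr_gt0.
  have t1 : t <= 1 by rewrite ge_min lexx.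
  have At : A ((1 - t) *: p + t *: a).
    have k01 : Itv.spec (@Itv.num_sem R) (Itv.Real `[0%Z, 1%Z]) t.
      by rewrite /= /Itv.num_sem /= num_real/= in_itv/= (ltW t0) t1.
    have := vA a p (Itv.mk k01); rewrite !inE => /(_ Aa Ap).
    by rewrite addrC.
  have := pmin ((1 - t) *: p + t *: a); rewrite inE => /(_ At).
  have -> : (1 - t) *: p + t *: a = p + t *: d.
    by rewrite /d scalerBl scale1r scalerBr -addrA [X in _ + X]addrC.
  rewrite /f addrAC.
  have : dot d (p - z) = - dot d (z - p) by rewrite -dotNr opprB.
  move: (p - z) => w dw; rewrite dotDl !dotDr !dotZl !dotZr (dotC w d) dw.
  have tD : t * (dot d d + 1) <= dot d (z - p) by rewrite -ler_pdivlMr// ge_min lexx orbT.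
  clear t1 At; clearbody t; move: t0 dzp tD; clear.
  move: (dot w w) (dot d d) (dot d (z - p)) => W dd D t0 D0 tD.
  have := ler_wpM2l (ltW t0) tD; have := mulr_gt0 t0 D0; have := mulr_gt0 t0 t0.
  lra.
have := Kz (z - p); rewrite leNgt => /negP; apply.
apply: le_lt_trans (_ : dot p (z - p) < _).
  apply: ge_sup; first by have [a Aa] := A0; exists (dot a (z - p)), a.
  by move=> _ [a Aa <-]; exact: far.
by rewrite -subr_gt0 -dotBl dot_gt0.
Qed.

(** Whatever body is chosen, it is the Wulff body of its own support function, so the choice is
    determined. *)
Lemma body_of_support_wulff h : sublinear h -> body_of_support h = wulff_body h.
Proof.
move=> sh; have [//|cK hK] := @xgetPex _ set0
  [set A | convex_body A /\ support_function A = h].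
  by exists (wulff_body h); split; [exact: wulff_body_convex_body|exact: support_function_wulff].
by rewrite -[in RHS]hK convex_body_wulff.
Qed.

End sublinear_functions.

(** * The volume of the body of a sublinear function *)

Section sublinear_continuity.
Variables (R : realType) (n : nat).
Implicit Types (h g : 'rV[R]_n -> R) (x y z xi : 'rV[R]_n).

(** The norm that measures errors between support functions: bounds at the vectors [± e_i] become a
    bound by a multiple of it. *)
Definition onenorm xi : R := \sum_i `|xi ord0 i|.

Lemma onenorm_ge0 xi : 0 <= onenorm xi.
Proof. by apply: sumr_ge0 => i _. Qed.

Lemma onenormN xi : onenorm (- xi) = onenorm xi.
Proof. by apply: eq_bigr => i _; rewrite mxE normrN. Qed.

Lemma onenorm_continuous : continuous onenorm.
Proof.
move=> x; apply: continuous_sum => i.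
by apply: (@continuous_comp _ _ _ (fun y : 'rV[R]_n => y ord0 i) Num.norm);
  [exact: coord_continuous|exact: norm_continuous].
Qed.

Lemma sublinear_onenorm : sublinear onenorm.
Proof.
split=> [x y|a x a0].
  by rewrite -big_split; apply: ler_sum => i _; rewrite mxE ler_normD.
by rewrite /onenorm mulr_sumr; apply: eq_bigr => i _; rewrite mxE normrM (ger0_norm a0).
Qed.

Lemma sublinear_dot z : sublinear (dot z).
Proof. by split=> [x y|a x _]; rewrite ?dotDr ?dotZr. Qed.

Lemma sublinear_comb (l m : R) h g : 0 <= l -> 0 <= m -> sublinear h -> sublinear g ->
  sublinear (fun xi => l * h xi + m * g xi).
Proof.
move=> l0 m0 [hD hZ] [gD gZ]; split=> [x y|a x a0].
  have := ler_wpM2l l0 (hD x y); have := ler_wpM2l m0 (gD x y); lra.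
by rewrite hZ// gZ//; ring.
Qed.

Lemma sublinear_le_onenorm h C : sublinear h ->
  (forall i, h (unit_vector R i) <= C /\ h (- unit_vector R i) <= C) ->
  forall x, h x <= C * onenorm x.
Proof.
move=> sh hC x; rewrite [X in h X](rV_sum_unit x).
apply: le_trans (sublinear_sum _ _ sh) _.
rewrite /onenorm mulr_sumr; apply: ler_sum => i _.
have [h1 h2] := hC i; have [x0|x0] := leP 0 (x ord0 i).
  by rewrite sh.2// ger0_norm// mulrC ler_wpM2r.
rewrite -[X in X *: _]opprK scaleNr -scalerN sh.2; last by rewrite oppr_ge0 ltW.
by rewrite ltr0_norm// mulrC ler_wpM2r// oppr_ge0 ltW.
Qed.

Lemma sublinear_lipschitz h C : sublinear h ->
  (forall i, h (unit_vector R i) <= C /\ h (- unit_vector R i) <= C) ->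
  forall x y, `|h x - h y| <= C * onenorm (x - y).
Proof.
move=> sh hC x y; have H := sublinear_le_onenorm sh hC.
rewrite ler_norml; apply/andP; split.
  have := sh.1 x (y - x); rewrite addrC subrK; have := H (y - x).
  by rewrite -(opprB x y) onenormN; lra.
by have := sh.1 y (x - y); rewrite addrC subrK; have := H (x - y); lra.
Qed.

Lemma sublinear_bound h : exists2 C, 0 <= C &
  forall i, h (unit_vector R i) <= C /\ h (- unit_vector R i) <= C.
Proof.
exists (\sum_i (`|h (unit_vector R i)| + `|h (- unit_vector R i)|)).
  by apply: sumr_ge0 => i _; exact: addr_ge0.
move=> i; rewrite (bigD1 i)//=.
set s := \sum_(_ | _) _; have s0 : 0 <= s by apply: sumr_ge0 => j _; exact: addr_ge0.
have := ler_norm (h (unit_vector R i)); have := ler_norm (h (- unit_vector R i)).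
have := normr_ge0 (h (unit_vector R i)); have := normr_ge0 (h (- unit_vector R i)).
by move: s0; split; lra.
Qed.

Lemma sublinear_onenorm_eq0 h x : sublinear h -> onenorm x = 0 -> h x = 0.
Proof.
move=> sh x0; have [C _ hC] := sublinear_bound h.
have := sublinear_le_onenorm sh hC x; have := sublinear_le_onenorm sh hC (- x).
have := sublinear_oppr x sh; rewrite onenormN x0 mulr0 => h1 h2 h3.
by apply: le_anti; apply/andP; split => //; lra.
Qed.

Lemma sublinear_continuous h : sublinear h -> continuous h.
Proof.
move=> sh x; have [C C0 hC] := sublinear_bound h.
apply/(@cvgrPdist_le _ _ _ (nbhs x)) => e e0.
have c1 : continuous (fun y : 'rV[R]_n => onenorm (x - y)).
  move=> y; apply: continuous_sum => i.
  have -> : (fun y : 'rV[R]_n => `|(x - y) ord0 i|) =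
      Num.norm \o (fun y : 'rV[R]_n => x ord0 i - y ord0 i).
    by apply/funext => w; rewrite /= !mxE.
  apply: continuous_comp; last exact: norm_continuous.
  by apply: continuousB; [exact: cst_continuous|exact: coord_continuous].
have : {for x, continuous (fun y : 'rV[R]_n => C * onenorm (x - y))}.
  by apply: continuousM; [exact: cst_continuous|exact: c1].
rewrite /prop_for /continuous_at subrr (sublinear0 sublinear_onenorm) mulr0.
move=> /cvgrPdist_le /(_ e e0); apply: filterS => y; rewrite sub0r normrN => hy.
apply: le_trans (sublinear_lipschitz sh hC x y) _.
exact: le_trans (ler_norm _) hy.
Qed.

Lemma onenorm_sphere_compact : compact [set xi : 'rV[R]_n | onenorm xi = 1].
Proof.
apply: (@bounded_entries_compact _ _ 1).
  by move=> x /= <- i; rewrite /onenorm (bigD1 i)//= lerDl sumr_ge0.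
apply: (@closed_comp _ _ onenorm [set 1]); last exact: closed_eq.
by move=> x _; exact: onenorm_continuous.
Qed.

End sublinear_continuity.

Section hyperplanes.
Variable R : realType.
Local Notation leb := (@lebesgue_measure R).

Lemma dot_rV_cons n (t : R) (v : 'rV[R]_n) (xi : 'rV[R]_n.+1) :
  dot (rV_cons (t, v)) xi = t * xi ord0 (lshift n ord0 : 'I_(1 + n)) +
    dot v (\row_j xi ord0 (rshift 1 j : 'I_(1 + n))).
Proof.
rewrite /dot (@big_split_ord _ _ _ 1 n) /= big_ord1 rV_cons0; congr (_ + _).
by apply: eq_bigr => j _; rewrite rV_consS mxE.
Qed.

Lemma measurable_hyperplane n (xi : 'rV[R]_n) (c : R) :
  measurable ([set x | dot x xi = c] : set (borel R n)).
Proof.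
apply: closed_borel; apply: (@closed_comp _ _ (fun x => dot x xi) [set c]).
  by move=> x _; exact: dot_continuous.
exact: closed_eq.
Qed.

(** If [xi] has a nonzero tail, all slices are hyperplanes of lower dimension; otherwise only the
    slice at the single point [c / a] is nonempty. *)
Lemma lebesgue_hyperplane n (xi : 'rV[R]_n) (c : R) : xi != 0 ->
  lebesgue_rV ([set x | dot x xi = c] : set (borel R n)) = 0%E.
Proof.
elim: n xi c => [|n IH] xi c xi0; first by move: xi0; rewrite thinmx0 eqxx.
set a := xi ord0 (lshift n ord0 : 'I_(1 + n)).
pose xi' : 'rV[R]_n := \row_j xi ord0 (rshift 1 j : 'I_(1 + n)).
have sliceE t : slice [set x | dot x xi = c] t = [set v | dot v xi' = c - t * a].
  apply/seteqP; split => v; rewrite /slice /= dot_rV_cons -/a -/xi'.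
    by move=> <-; rewrite addrC addKr.
  by move=> ->; rewrite addrC subrK.
rewrite lebesgue_rVS.
have [xi'0|xi'0] := eqVneq xi' 0; last first.
  by apply: integral0_eq => t _; rewrite sliceE IH.
have a0 : a != 0.
  apply: contra xi0 => /eqP a0; apply/eqP/rowP => j; rewrite mxE.
  case: (@split_ordP 1 n j) => i ->; first by rewrite (ord1 i).
  by have /rowP/(_ i) := xi'0; rewrite !mxE.
rewrite (@ge0_negligible_integral _ _ _ leb setT [set c / a])//; last 2 first.
- by apply: measurable_lebesgue_slice; exact: measurable_hyperplane.
- exact: lebesgue_measure_set1.
apply: integral0_eq => t [_ /= tn]; rewrite sliceE [X in lebesgue_rV X](_ : _ = set0) ?measure0//.
rewrite -subset0 => v /=; rewrite xi'0 -(scale0r 0) dotZr mul0r => h.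
by apply: tn; rewrite -[c](subrK (t * a)) -h add0r mulfK.
Qed.

End hyperplanes.

Section volume_root.
Variables (R : realType) (n : nat).
Hypothesis n_gt0 : (0 < n)%N.
Implicit Types (h g : 'rV[R]_n -> R) (x y z xi : 'rV[R]_n).
Local Notation vol h := (lebesgue_rV (wulff_body h : set (borel R n))).

Definition volume_root h : R := fine (vol h) `^ (n%:R^-1).

Lemma wulff_volume_lty h : (vol h < +oo)%E.
Proof.
have [M bM] := wulff_body_bounded h.
by apply: lebesgue_rV_lty bM; exact: measurable_wulff_body.
Qed.

Lemma wulff_volume_fineK h : (fine (vol h))%:E = vol h.
Proof. by rewrite fineK// ge0_fin_numE// wulff_volume_lty. Qed.

Lemma volume_root_ge0 h : 0 <= volume_root h.
Proof. exact: powR_ge0. Qed.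

Lemma volume_rootK h : ((volume_root h ^+ n)%:E = vol h)%E.
Proof.
rewrite -powR_mulrn ?powR_ge0// -powRrM mulVf ?pnatr_eq0 -?lt0n//.
by rewrite powRr1 ?fine_ge0// wulff_volume_fineK.
Qed.

Lemma le_volume_root h a : 0 <= a -> ((a ^+ n)%:E <= vol h)%E = (a <= volume_root h).
Proof.
move=> a0; rewrite -volume_rootK lee_fin ler_pXn2r ?nnegrE ?volume_root_ge0//.
Qed.

Lemma volume_root_mono h g : (forall xi, h xi <= g xi) -> volume_root h <= volume_root g.
Proof.
move=> hg; rewrite -le_volume_root ?volume_root_ge0// volume_rootK.
apply: le_measure; rewrite ?inE; try exact: measurable_wulff_body.
by move=> z Kz xi; exact: le_trans (Kz xi) (hg xi).
Qed.

(** Brunn-Minkowski, with the Wulff body of the combination as the set containing the Minkowski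
    combination. *)
Lemma volume_root_concave (l m : R) h g : 0 <= l -> 0 <= m -> sublinear h -> sublinear g ->
  l * volume_root h + m * volume_root g <= volume_root (fun xi => l * h xi + m * g xi).
Proof.
move=> l0 m0 sh sg; rewrite -le_volume_root; last first.
  by rewrite addr_ge0// mulr_ge0// volume_root_ge0.
have [M1 b1] := wulff_body_bounded h; have [M2 b2] := wulff_body_bounded g.
apply: (@brunn_minkowski_natpow R n (wulff_body h) (wulff_body g) _ (Num.max M1 M2)) => //;
  try exact: measurable_wulff_body; try exact: wulff_body_convex;
  try exact: wulff_body_nonempty; try exact: volume_root_ge0.
- by move=> z Kz i; rewrite le_max b1.
- by move=> z Kz i; rewrite le_max b2 ?orbT.
- by move=> x y Kx Ky xi; rewrite dotDl !dotZl lerD// ler_wpM2l.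
- by rewrite volume_rootK.
- by rewrite volume_rootK.
Qed.

(** The enlarged bodies decrease to the Wulff body of [h] and have finite volume, so the measure is
    continuous from above along them. *)
Lemma volume_root_limit h L :
  (forall k : nat, L <= volume_root (fun xi => h xi + k.+1%:R^-1 * onenorm xi)) ->
  L <= volume_root h.
Proof.
move=> hL; have [L0|L0] := leP L 0; first exact: le_trans L0 (volume_root_ge0 h).
rewrite -le_volume_root ?(ltW L0)//.
pose F k : set (borel R n) := wulff_body (fun xi => h xi + k.+1%:R^-1 * onenorm xi).
have capF : wulff_body h = \bigcap_k F k.
  apply/seteqP; split => z /= Kz.
    move=> k _ xi; apply: le_trans (Kz xi) _.
    by rewrite lerDl mulr_ge0// ?onenorm_ge0// invr_ge0.
  move=> xi; rewrite leNgt; apply/negP => hz.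
  pose e := (dot z xi - h xi) / (onenorm xi + 1).
  have N1 : 0 < onenorm xi + 1 by rewrite ltr_wpDl// onenorm_ge0.
  have e0 : 0 < e by rewrite divr_gt0// subr_gt0.
  have [k _ /(_ k (leqnn k))/= ke] := near_infty_natSinv_lt (PosNum e0).
  have := Kz k I xi.
  have : k.+1%:R^-1 * (onenorm xi + 1) < dot z xi - h xi by rewrite -ltr_pdivlMr.
  have : 0 < k.+1%:R^-1 :> R by rewrite invr_gt0.
  by move: (k.+1%:R^-1) => q h1 h2 h3; lra.
have mF k : measurable (F k) by exact: measurable_wulff_body.
have niF : nonincreasing_seq F.
  move=> i j ij; apply/subsetPset => z Kz xi; apply: le_trans (Kz xi) _.
  by rewrite lerD2l ler_wpM2r ?onenorm_ge0// lef_pV2 ?posrE// ler_nat.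
have := @nonincreasing_cvg_mu _ _ R (@lebesgue_rV R n) F (wulff_volume_lty _) mF _ niF.
rewrite -capF => /(_ (measurable_wulff_body h)) cvF.
rewrite -(cvg_lim _ cvF)//; apply: lime_ge; first by apply/cvg_ex; exists (vol h).
by apply: nearW => k /=; rewrite le_volume_root// ltW.
Qed.

(** The conclusion says that the body contains the cube of centre [p] and half-side [rho].
    Supporting hyperplanes are null, so every direction has a point of the body strictly below its
    support value; by compactness finitely many points serve all directions, and a convex
    combination of them serves all at once. The least gap on the unit sphere is [rho]. *)
Lemma wulff_body_interior h : sublinear h -> (0 < vol h)%E ->
  exists p rho, 0 < rho /\ forall xi, dot p xi + rho * onenorm xi <= h xi.
Proof.
move=> sh vh.
have strict xi : xi != 0 -> exists2 z, wulff_body h z & dot z xi < h xi.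
  move=> xi0; apply: contrapT => noz.
  have : (vol h <= lebesgue_rV ([set x | dot x xi = h xi] : set (borel R n)))%E.
    apply: le_measure; rewrite ?inE; [exact: measurable_wulff_body|exact: measurable_hyperplane|].
    move=> z Kz /=; apply: le_anti; rewrite Kz/= leNgt; apply/negP => hz.
    by apply: noz; exists z.
  by rewrite lebesgue_hyperplane// leNgt vh.
have avg (s : seq 'rV[R]_n) : (forall z, z \in s -> wulff_body h z) ->
    exists2 p, wulff_body h p & forall z, z \in s -> forall xi, dot z xi < h xi -> dot p xi < h xi.
  elim: s => [_|z s IH Ks]; first by have [p Kp] := wulff_body_nonempty sh; exists p.
  have [|p Kp Hp] := IH; first by move=> w ws; apply: Ks; rewrite inE ws orbT.
  have Kz : wulff_body h z by apply: Ks; rewrite mem_head.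
  (* Halving keeps a positive weight on every earlier point, so each strict inequality persists. *)
  exists (2^-1 *: (z + p)).
    by move=> xi; rewrite dotZl dotDl; have := Kz xi; have := Kp xi; lra.
  move=> w; rewrite inE => /predU1P[->|ws] xi hw; rewrite dotZl dotDl.
    by have := Kp xi; lra.
  by have := Hp _ ws _ hw; have := Kz xi; lra.
pose S := [set xi : 'rV[R]_n | onenorm xi = 1].
have S_neq0 xi : S xi -> xi != 0.
  move=> S1; apply/eqP => xi0; move: S1.
  by rewrite /S /= xi0 (sublinear0 (@sublinear_onenorm R n)) => /esym/eqP; rewrite oner_eq0.
have cS : compact S by exact: onenorm_sphere_compact.
have ch := sublinear_continuous sh.
have := cS; rewrite compact_cover => /(_ _ (wulff_body h) (fun z => [set xi | dot z xi < h xi])).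
case.
- move=> z _.
  have -> : [set xi | dot z xi < h xi] = (fun xi => h xi - dot z xi) @^-1` [set t | 0 < t].
    by apply/seteqP; split => xi /=; rewrite subr_gt0.
  apply: open_comp => [xi _|]; last exact: open_gt.
  by apply: continuousB; [exact: ch|exact: (sublinear_continuous (sublinear_dot z))].
- by move=> xi /S_neq0/strict[z Kz hz]; exists z.
move=> D DK SD.
have [|p Kp Hp] := avg (finmap.enum_fset D).
  by move=> z zD; have := DK z zD; rewrite inE.
have pS xi : S xi -> dot p xi < h xi.
  by move=> /SD[z zD /= hz]; exact: Hp hz.
have [|||c] := @EVT_min_rV R n (fun xi => h xi - dot p xi) S.
- exists (unit_vector R (Ordinal n_gt0)); rewrite /S /= /onenorm (bigD1 (Ordinal n_gt0))//=.
  by rewrite mxE !eqxx normr1 big1 ?addr0// => i /negbTE ni; rewrite mxE ni normr0.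
- exact: cS.
- apply: continuous_subspaceT => xi.
  by apply: continuousB; [exact: ch|exact: (sublinear_continuous (sublinear_dot p))].
rewrite inE => Sc cmin.
exists p, (h c - dot p c); split; first by rewrite subr_gt0 pS.
move=> xi; have [xi0|xi0] := eqVneq (onenorm xi) 0.
  by rewrite xi0 mulr0 addr0.
have N0 : 0 < onenorm xi by rewrite lt_neqAle eq_sym xi0 onenorm_ge0.
have := cmin ((onenorm xi)^-1 *: xi).
rewrite inE /S /= (@sublinear_onenorm R n).2 ?invr_ge0 ?(ltW N0)// mulVf// => /(_ erefl).
rewrite sh.2 ?invr_ge0 ?(ltW N0)// dotZr -mulrBr ler_pdivlMl// mulrC; lra.
Qed.

(** With [e = d * rho], the lower bound on [g] is at least [(1 - d) * h xi + d * dot p xi]: the body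
    of [g] contains that of [h] shrunk towards [p] by the factor [1 - d]. *)
Lemma volume_root_lsc h a : sublinear h -> a < volume_root h ->
  exists2 e, 0 < e & forall g, sublinear g ->
    (forall xi, h xi - e * onenorm xi <= g xi) -> a < volume_root g.
Proof.
move=> sh ah; have [V0|V0] := leP (volume_root h) 0.
  exists 1 => // g _ _; apply: lt_le_trans ah (le_trans V0 (volume_root_ge0 g)).
have vh : (0 < vol h)%E by rewrite -volume_rootK lte_fin exprn_gt0.
have [p [rho [rho0 hp]]] := wulff_body_interior sh vh.
(* The factor 2 makes [(1 - d) * volume_root h > a] strict. *)
pose d := Num.min 1 ((volume_root h - a) / (2 * volume_root h)).
have d0 : 0 < d by rewrite lt_min ltr01 divr_gt0// ?subr_gt0// mulr_gt0.
have d1 : d <= 1 by rewrite ge_min lexx.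
have dV : d * volume_root h < volume_root h - a.
  have : d * (2 * volume_root h) <= volume_root h - a.
    by rewrite -ler_pdivlMr ?mulr_gt0// ge_min lexx orbT.
  have := mulr_gt0 d0 V0; lra.
exists (d * rho); first exact: mulr_gt0.
move=> g sg hg.
apply: (@lt_le_trans _ _ ((1 - d) * volume_root h)); first by lra.
apply: (@le_trans _ _ (volume_root (fun xi => (1 - d) * h xi + d * dot p xi))).
  have := @volume_root_concave (1 - d) d h (dot p) _ _ sh (sublinear_dot p).
  rewrite subr_ge0 => /(_ d1 (ltW d0)); apply: le_trans.
  by rewrite lerDl mulr_ge0// ?volume_root_ge0// ltW.
apply: volume_root_mono => xi; apply: le_trans (hg xi).
have := ler_wpM2l (ltW d0) (hp xi); lra.
Qed.

End volume_root.

(** * Integration over 'rV[R]_n *)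

Section bounded_measurable_functions.
Variable R : realType.
Local Notation leb := (@lebesgue_measure R).

(** One [K] bounds both the values and the support. Such functions are integrable and the class is
    stable under sections, as repeated use of Fubini requires. *)
Definition bounded_measurable n (F : 'rV[R]_n -> R) :=
  measurable_fun [set: borel R n] (F : borel R n -> R) /\
  exists K, forall x, `|F x| <= K /\ (F x != 0 -> forall i, `|x ord0 i| <= K).

Lemma bounded_measurable_integrable n (F : 'rV[R]_n -> R) :
  bounded_measurable F -> (@lebesgue_rV R n).-integrable setT (EFin \o F : borel R n -> \bar R).
Proof.
move=> [mF [K FK]].
have [k Kk] : exists k : nat, K < k.+1%:R.
  exists (Num.bound `|K|).
  by rewrite (le_lt_trans (ler_norm K))// (lt_le_trans (archi_boundP (normr_ge0 K)))// ler_nat.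
pose B : set (borel R n) := ball (0 : 'rV[R]_n) k.+1%:R.
have mB : measurable B by apply: sub_sigma_algebra; exact: ball_open.
have Bfin : (lebesgue_rV B < +oo)%E.
  apply: (@lebesgue_rV_lty R n k.+1%:R) => // x [_ xk] i.
  by have := xk ord0 i; rewrite /ball /= mxE sub0r normrN => /ltW.
have FB : (EFin \o F : borel R n -> \bar R) \_ B = EFin \o F.
  apply/funext => x; rewrite patchE; case: ifPn => // xB /=.
  have [->//|Fx0] := eqVneq (F x) 0; case/negP: xB; rewrite inE; split=> // i j.
  by rewrite ord1 /ball /= mxE sub0r normrN (le_lt_trans ((FK x).2 Fx0 j)).
rewrite -FB; apply/(integrable_mkcond _ mB); apply: measurable_bounded_integrable => //.
- exact: measurable_funTS.
- exists K; split; first exact: num_real.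
  by move=> L KL x _ /=; exact: le_trans (FK x).1 (ltW KL).
Qed.

Lemma measurable_rV_cons_section n (t : R) :
  measurable_fun [set: borel R n] (fun v => rV_cons (t, v) : borel R n.+1).
Proof.
apply: (measurableT_comp (@measurable_rV_cons R n)).
exact: pair1_measurable.
Qed.

Lemma bounded_measurable_section n (F : 'rV[R]_n.+1 -> R) t : bounded_measurable F ->
  bounded_measurable (fun v => F (rV_cons (t, v))).
Proof.
move=> [mF [K FK]]; split.
  exact: (measurableT_comp mF (measurable_rV_cons_section t)).
exists K => v; split; first exact: (FK _).1.
by move=> /((FK _).2) /= vK i; have := vK (rshift 1 i : 'I_(1 + n)); rewrite rV_consS.
Qed.

Lemma integral_rVS n (F : 'rV[R]_n.+1 -> R) : bounded_measurable F ->
  (\int[@lebesgue_rV R n.+1]_x (F x)%:E =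
   \int[leb]_t \int[@lebesgue_rV R n]_v (F (rV_cons (t, v)))%:E)%E /\
  (\int[@lebesgue_rV R n.+1]_x (F x)%:E =
   \int[@lebesgue_rV R n]_v \int[leb]_t (F (rV_cons (t, v)))%:E)%E.
Proof.
move=> bF; have iF := bounded_measurable_integrable bF.
have mFE : measurable_fun [set: borel R n.+1] (EFin \o F : borel R n.+1 -> \bar R).
  by apply/measurable_EFinP; case: bF.
pose P := [the measure _ _ of product_measure1 leb (@lebesgue_rV R n)].
have mc : measurable_fun [set: measurableTypeR R * borel R n] (@rV_cons R n : _ -> borel R n.+1).
  exact: measurable_rV_cons.
have pushE (f : borel R n.+1 -> \bar R) :
    (\int[@lebesgue_rV R n.+1]_x f x = \int[pushforward P (@rV_cons R n : _ -> borel R n.+1)]_x f x)%E.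
  exact: eq_measure_integral.
have iP : P.-integrable setT ((EFin \o F : borel R n.+1 -> \bar R) \o @rV_cons R n).
  apply/integrableP; split; first exact: measurableT_comp.
  have /integrableP[_] := iF; rewrite pushE ge0_integral_pushforward//.
  exact: measurableT_comp.
rewrite pushE (@integral_pushforward _ _ _ _ _ _ mc P setT _ mFE iP measurableT) preimage_setT.
split.
  by rewrite -(@integral12_prod_meas1 _ _ _ _ R leb (@lebesgue_rV R n) _ iP).
by rewrite -(@integral21_prod_meas1 _ _ _ _ R leb (@lebesgue_rV R n) _ iP).
Qed.

Lemma add_scale_rVE n (x y : 'rV[R]_n) (s : R) j :
  (x + s *: y) ord0 j = x ord0 j + s * y ord0 j.
Proof. by rewrite !mxE. Qed.

Lemma unit_vectorE n (i j : 'I_n) : unit_vector R i ord0 j = (j == i)%:R.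
Proof. by rewrite mxE eqxx. Qed.

Lemma rV_cons_unit0 n (t : R) (v : 'rV[R]_n) :
  rV_cons (t, v) = rV_cons (0, v) + t *: unit_vector R (lshift n ord0 : 'I_(1 + n)).
Proof.
apply/rowP => l; rewrite add_scale_rVE unit_vectorE.
case: (@split_ordP 1 n l) => b ->.
  by rewrite !rV_cons0 (ord1 b) !eqxx mulr1 add0r.
by rewrite !rV_consS -val_eqE /= mulr0 addr0.
Qed.

Lemma rV_cons_unitS n (t s : R) (v : 'rV[R]_n) (k : 'I_n) :
  rV_cons (t, v + s *: unit_vector R k) = rV_cons (t, v) + s *: unit_vector R (rshift 1 k : 'I_(1 + n)).
Proof.
apply/rowP => l; rewrite add_scale_rVE unit_vectorE.
case: (@split_ordP 1 n l) => b ->.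
  by rewrite !rV_cons0 -val_eqE /= (ord1 b) mulr0 addr0.
by rewrite !rV_consS add_scale_rVE unit_vectorE -[in RHS]val_eqE /= eqn_add2l.
Qed.

Lemma coord_le_norm n (x : 'rV[R]_n) i : `|x ord0 i| <= `|x|.
Proof.
rewrite leNgt; apply/negP => xi.
have : ball (0 : 'rV[R]_n) `|x ord0 i| x by rewrite mx_norm_ball /ball_ /= sub0r normrN.
by move=> [_ /(_ ord0 i)]; rewrite /ball /= mxE sub0r normrN ltxx.
Qed.

(** Fubini with the [i]-th coordinate innermost: the order of integration is exchanged if it is the
    first coordinate, otherwise the first one is peeled off. *)
Lemma integral_coordinate_zero n (i : 'I_n) (F : 'rV[R]_n -> R) : bounded_measurable F ->
  (forall x, \int[leb]_t (F (x + t *: unit_vector R i))%:E = 0)%E ->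
  (\int[@lebesgue_rV R n]_x (F x)%:E = 0)%E.
Proof.
elim: n i F => [|n IH] i F bF F0; first by case: i F0.
have [E1 E2] := integral_rVS bF.
case: (@split_ordP 1 n i) F0 => k -> F0.
  rewrite E2; apply: integral0_eq => v _.
  under eq_integral do rewrite rV_cons_unit0.
  by have := F0 (rV_cons (0, v)); rewrite (ord1 k).
rewrite E1; apply: integral0_eq => t _.
apply: (IH k _ (bounded_measurable_section t bF)) => v.
by under eq_integral do rewrite rV_cons_unitS.
Qed.

Lemma within_continuous_measurable n (D : set 'rV[R]_n) (f : 'rV[R]_n -> R) :
  measurable (D : set (borel R n)) ->
  (forall x, D x -> f y @[y --> within D (nbhs x)] --> f x) ->
  measurable_fun (D : set (borel R n)) (f : borel R n -> R).
Proof.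
move=> mD cf; apply: (measurability _ (RGenOpens.measurableE R)).
move=> _ [_ [a [b ->] <-]].
(* The implication turns continuity within [D] into a statement on full neighbourhoods, so the
   preimage is the trace on [D] of an open set. *)
pose O := ([set y | D y -> f y \in `]a, b[])^°.
have -> : D `&` f @^-1` [set` `]a, b[] = D `&` O.
  apply/seteqP; split => x [Dx]; last by move=> /interior_subset /(_ Dx).
  move=> /= fx; split => //; rewrite /O /interior /=.
  have : nbhs (f x) [set` `]a, b[].
    by apply: open_nbhs_nbhs; split => //; exact: interval_open.
  by move=> /(cf x Dx).
apply: measurableI => //; apply: sub_sigma_algebra; exact: open_interior.
Qed.

Lemma restrict_bounded_measurable n (D B : set 'rV[R]_n) (f : 'rV[R]_n -> R) :
  compact D -> B `<=` D -> measurable (B : set (borel R n)) ->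
  (forall x, D x -> f y @[y --> within D (nbhs x)] --> f x) ->
  bounded_measurable (f \_ B).
Proof.
move=> cD BD mB cf.
have clD : closed D by apply: compact_closed => //; exact: norm_hausdorff.
have mf : measurable_fun (D : set (borel R n)) (f : borel R n -> R).
  by apply: within_continuous_measurable => //; exact: closed_borel.
split.
  apply/(measurable_restrictT (f : borel R n -> R) mB).
  by apply: measurable_funS mf => //; exact: closed_borel.
have [M1 [_ hM1]] := compact_bounded cD.
have wf : {within D, continuous f} by apply/subspace_continuousP.
have [M2 [_ hM2]] := compact_bounded (continuous_compact wf cD).
pose K := Num.max 0 (Num.max (M1 + 1) (M2 + 1)).
exists K => x; rewrite patchE; case: ifPn => [|_]; last first.
  by rewrite normr0 eqxx; split => //; rewrite le_max lexx.
rewrite inE => /BD Dx; split.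
  apply: (@le_trans _ _ (M2 + 1)); last by rewrite !le_max lexx !orbT.
  by apply: hM2; [rewrite ltrDl|exists x].
move=> _ i; apply: (@le_trans _ _ (M1 + 1)); last by rewrite !le_max lexx !orbT.
by apply: le_trans (coord_le_norm x i) (hM1 (M1 + 1) _ x Dx); rewrite ltrDl.
Qed.

End bounded_measurable_functions.

(** * The mean value property of harmonic functions *)

Section directional_derivatives.
Variables (R : realType) (n : nat).
Implicit Types (f u : 'rV[R]_n -> R) (x y z b a : 'rV[R]_n).

Lemma is_derive_line f b a (t : R) : derivable f (b + t *: a) a ->
  is_derive t 1 (fun s : R => f (b + s *: a)) ('D_a f (b + t *: a)).
Proof.
have E : (fun h : R => h^-1 *: (((fun s : R => f (b + s *: a)) \o shift t) (h *: (1 : R)) -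
    f (b + t *: a))) =
  (fun h : R => h^-1 *: ((f \o shift (b + t *: a)) (h *: a) - f (b + t *: a))).
  apply/funext => h /=; congr (_ *: (f _ - _)).
  by rewrite [h *: 1]mulr1 scalerDl addrCA.
by move=> df; split; rewrite /derivable /derive E.
Qed.

(* Difference quotients converge uniformly in the base point near [z]. *)
Definition strictly_derivable u z a (alpha : R) := forall e, 0 < e ->
  exists2 d, 0 < d & forall y t, `|y - z| < d -> `|t| < d ->
    `|u (y + t *: a) - u y - t * alpha| <= e * `|t|.

Lemma strictly_derivable0 u z : strictly_derivable u z 0 0.
Proof.
move=> e e0; exists 1 => // y t _ _.
by rewrite scaler0 addr0 subrr mulr0 subr0 normr0 mulr_ge0// ltW.
Qed.

(** The increment is split at [y + t *: a1]; uniformity in the base point allows the second estimate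
    to be used there. This replaces Frechet differentiability in the chain rule along lines. *)
Lemma strictly_derivableD u z a1 a2 (c1 c2 : R) :
  strictly_derivable u z a1 c1 -> strictly_derivable u z a2 c2 ->
  strictly_derivable u z (a1 + a2) (c1 + c2).
Proof.
move=> h1 h2 e e0; have e2 : 0 < e / 2 by rewrite divr_gt0.
have [d1 d10 H1] := h1 _ e2; have [d2 d20 H2] := h2 _ e2.
have N1 : 0 < 1 + `|a1| by rewrite ltr_wpDr.
exists (Num.min d1 (d2 / (1 + `|a1|))); first by rewrite lt_min d10 divr_gt0.
move=> y t; rewrite !lt_min => /andP[y1 y2] /andP[t1 t2].
have yd2 : `|y + t *: a1 - z| < d2.
  rewrite addrAC (le_lt_trans (ler_normD _ _))// normrZ.
  have dE : d2 / (1 + `|a1|) * (1 + `|a1|) = d2 by rewrite divfK// gt_eqF.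
  have := ler_wpM2r (normr_ge0 a1) (ltW t2); move: y2 dE.
  by move: (d2 / _) => d'; lra.
have td2 : `|t| < d2.
  by rewrite (lt_le_trans t2)// ler_pdivrMr// ler_peMr ?(ltW d20)// lerDl.
have {}H1 := H1 y t y1 t1; have {}H2 := H2 _ t yd2 td2.
have -> : u (y + t *: (a1 + a2)) - u y - t * (c1 + c2) =
   (u (y + t *: a1 + t *: a2) - u (y + t *: a1) - t * c2) + (u (y + t *: a1) - u y - t * c1).
  by rewrite scalerDr addrA; ring.
rewrite (le_trans (ler_normD _ _))// (le_trans (lerD H2 H1))//.
by rewrite -mulrDl -splitr.
Qed.

Lemma strictly_derivableZ u z a (c s : R) :
  strictly_derivable u z a c -> strictly_derivable u z (s *: a) (s * c).
Proof.
move=> h e e0; have N1 : 0 < 1 + `|s| by rewrite ltr_wpDr.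
have [d d0 H] := h (e / (1 + `|s|)) (divr_gt0 e0 N1).
exists (d / (1 + `|s|)); first exact: divr_gt0.
move=> y t yd td.
have dd : d / (1 + `|s|) <= d by rewrite ler_pdivrMr// ler_peMr ?(ltW d0)// lerDl.
have tsd : `|t * s| < d.
  rewrite normrM; apply: le_lt_trans (_ : `|t| * (1 + `|s|) < d).
    by rewrite ler_wpM2l// lerDr.
  by rewrite -ltr_pdivlMr.
have := H y (t * s) (lt_le_trans yd dd) tsd.
rewrite scalerA mulrA => /le_trans; apply.
have -> : e / (1 + `|s|) * `|t * s| = e * `|t| * (`|s| / (1 + `|s|)).
  by rewrite normrM; field; rewrite gt_eqF.
by rewrite ler_piMr ?mulr_ge0 ?(ltW e0)// ler_pdivrMr// mul1r lerDr.
Qed.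

Lemma strictly_derivable_sum (I : Type) (s : seq I) u z (F : I -> 'rV[R]_n) (c : I -> R) :
  (forall i, strictly_derivable u z (F i) (c i)) ->
  strictly_derivable u z (\sum_(i <- s) F i) (\sum_(i <- s) c i).
Proof.
move=> h; elim/big_ind2 : _ => //; [exact: strictly_derivable0|].
by move=> *; exact: strictly_derivableD.
Qed.

Lemma is_derive_strict u b a (t c : R) : strictly_derivable u (b + t *: a) a c ->
  is_derive t 1 (fun s : R => u (b + s *: a)) c.
Proof.
move=> h.
have E : (fun h : R => h^-1 *: (((fun s : R => u (b + s *: a)) \o shift t) (h *: (1 : R)) -
    u (b + t *: a))) @ 0^' --> c.
  apply/cvgrPdist_le => e e0; have [d d0 H] := h e e0.
  near=> k.
  have k0 : k != 0 by near: k; exact: nbhs_dnbhs_neq.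
  have kd : `|k| < d.
    near: k; apply: dnbhs0_lt => //.
  have := H (b + t *: a) k; rewrite subrr normr0 => /(_ d0 kd).
  rewrite /= [k *: 1]mulr1.
  have -> : b + (k + t) *: a = b + t *: a + k *: a.
    by rewrite scalerDl -addrA [t *: a + _]addrC.
  move=> hk; rewrite -(ler_pM2r (_ : 0 < `|k|)) ?normr_gt0//.
  rewrite -normrM; apply: le_trans hk; rewrite -normrN.
  have -> // : - ((c - k^-1 * (u (b + t *: a + k *: a) - u (b + t *: a))) * k) =
    u (b + t *: a + k *: a) - u (b + t *: a) - k * c by field.
by split; [apply/cvg_ex; exists c|exact/cvg_lim].
Unshelve. all: by end_near. Qed.

(** By the mean value theorem the increment is [t] times the partial derivative at an intermediate
    point, which continuity keeps within [e] of its value at [z]. *)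
Lemma strictly_derivable_unit (U : set 'rV[R]_n) u (i : 'I_n) z : open U -> U z ->
  (forall x, U x -> derivable u x (unit_vector R i)) ->
  (forall x, U x -> {for x, continuous (partial i u)}) ->
  strictly_derivable u z (unit_vector R i) (partial i u z).
Proof.
move=> oU Uz du cu e e0.
have : \forall y \near z, U y /\ `|partial i u z - partial i u y| <= e.
  near=> y; split; near: y; first exact: open_nbhs_nbhs.
  by have /cvgrPdist_le := cu z Uz; exact.
move=> /nbhs_ballP[d /= d0 hd].
pose N := `|unit_vector R i : 'rV[R]_n|.
have N1 : 0 < 1 + N by rewrite ltr_wpDr ?normr_ge0.
exists (d / (1 + N)); first exact: divr_gt0.
move=> y t yz td.
have hU c : `|c| <= `|t| -> U (y + c *: unit_vector R i) /\
    `|partial i u z - partial i u (y + c *: unit_vector R i)| <= e.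
  move=> ct; apply: hd.
  rewrite mx_norm_ball /ball_ /= -normrN opprB addrAC (le_lt_trans (ler_normD _ _))//.
  have tN : `|c *: unit_vector R i : 'rV[R]_n| <= `|t| * N.
    by rewrite normrZ ler_wpM2r.
  apply: le_lt_trans (lerD (lexx _) tN) _.
  have dE : d / (1 + N) * (1 + N) = d by rewrite divfK// gt_eqF.
  have := ler_wpM2r (normr_ge0 _ : 0 <= N) (ltW td); move: yz dE.
  by move: (d / _) => d'; lra.
pose g c := u (y + c *: unit_vector R i).
have dg (c : R) : `|c| <= `|t| -> is_derive c 1 g (partial i u (y + c *: unit_vector R i)).
  by move=> /hU[Uc _]; exact: is_derive_line (du _ Uc).
have cg (a b : R) : (forall c : R, c \in `[a, b]%R -> `|c| <= `|t|) -> {within `[a, b], continuous g}.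
  move=> H; apply: derivable_within_continuous => c /H /dg dgc; exact: ex_derive.
have [c ct uE] : exists2 c, `|c| <= `|t| &
    g t - g 0 = partial i u (y + c *: unit_vector R i) * t.
  have [t0|t0] := leP 0 t.
    have H c : c \in `[0, t]%R -> `|c| <= `|t|.
      by rewrite in_itv/= => /andP[c0 c1]; rewrite !ger0_norm.
    case: (@MVT_segment R g (fun c => partial i u (y + c *: unit_vector R i)) 0 t t0 _ (cg _ _ H)) => [|c cI E].
      by move=> c cI; apply: dg; apply: H; exact: subset_itv_oo_cc cI.
    by exists c; [exact: H|rewrite E subr0].
  have H c : c \in `[t, 0]%R -> `|c| <= `|t|.
    by rewrite in_itv/= => /andP[c0 c1]; rewrite !ler0_norm ?lerN2// ltW.
  case: (@MVT_segment R g (fun c => partial i u (y + c *: unit_vector R i)) t 0 (ltW t0) _ (cg _ _ H)) => [|c cI E].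
    by move=> c cI; apply: dg; apply: H; exact: subset_itv_oo_cc cI.
  by exists c; [exact: H|rewrite -[LHS]opprB E sub0r mulrN opprK].
rewrite /g scale0r addr0 in uE; rewrite uE mulrC -mulrBr normrM mulrC ler_wpM2r//.
by rewrite distrC; case: (hU c ct).
Unshelve. all: by end_near. Qed.

End directional_derivatives.

Section continuity_tools.
Variable R : realType.
Local Notation leb := (@lebesgue_measure R).

Lemma continuous_rV (T : topologicalType) k (f : T -> 'rV[R]_k) t :
  (forall i, {for t, continuous (fun s => f s ord0 i)}) -> {for t, continuous f}.
Proof.
move=> cf; apply/(@cvg_ballP _ _ _ (nbhs t)) => e e0.
have : \forall s \near t, forall i, `|f t ord0 i - f s ord0 i| < e.
  apply: filter_forall => i.
  by have /cvgrPdist_lt := cf i; exact.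
apply: filterS => s H; split => // i j; rewrite ord1; exact: H.
Qed.

(** The closed interval is for the parameter along a ray, the open one for the chords of an open
    ball. *)
Lemma FTC_segment (f F : R -> R) (a b : R) : a < b ->
  (forall t, a <= t <= b -> is_derive t 1 F (f t)) ->
  (forall t, a <= t <= b -> {for t, continuous f}) ->
  (\int[leb]_(t in `[a, b]) (f t)%:E = (F b - F a)%:E)%E /\
  (\int[leb]_(t in `]a, b[) (f t)%:E = (F b - F a)%:E)%E.
Proof.
move=> ab dF cf.
have wcf : {within `[a, b], continuous f}.
  apply/continuous_in_subspaceT => t; rewrite inE /= in_itv; exact: cf.
have cF t : a <= t <= b -> {for t, continuous F}.
  by move=> /dF dFt; apply: differentiable_continuous; apply/derivable1_diffP; exact: ex_derive.
have E : (\int[leb]_(t in `[a, b]) (f t)%:E = (F b - F a)%:E)%E.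
  rewrite EFinB; apply: continuous_FTC2 => //.
    split.
    - move=> t tab; have tab' : a <= t <= b by have := subset_itv_oo_cc tab; rewrite in_itv.
      by have := dF t tab' => dFt; exact: ex_derive.
    - by apply: cvg_at_right_filter; apply: cF; rewrite lexx ltW.
    - by apply: cvg_at_left_filter; apply: cF; rewrite lexx ltW.
  move=> t tab; have tab' : a <= t <= b by have := subset_itv_oo_cc tab; rewrite in_itv.
  by have := dF t tab' => dFt; rewrite derive1E derive_val.
have mf : measurable_fun (`[a, b]%classic : set R) (EFin \o f).
  by apply/measurable_EFinP; apply: subspace_continuous_measurable_fun.
split => //; rewrite -E integral_itv_obnd_cbnd; last first.
  by apply: measurable_funS mf => //; exact: subset_itv_oo_cc.
rewrite integral_itv_bndo_bndc//.
by apply: measurable_funS mf => //; exact: subset_itv_co_cc.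
Qed.

Lemma continuous_within (T : topologicalType) (f : T -> R) (D : set T) t :
  {for t, continuous f} -> f s @[s --> within D (nbhs t)] --> f t.
Proof. by move=> cf; apply: cvg_within_filter. Qed.

End continuity_tools.

Section euclidean_balls.
Variables (R : realType) (m : nat).
Implicit Types (x y : 'rV[R]_m) (r : R).

Lemma eballE x r : 0 < r -> eball x r = [set y | dot (y - x) (y - x) < r ^+ 2].
Proof.
move=> r0; have H d : (Num.sqrt d < r) = (d < r ^+ 2).
  by rewrite -[in LHS](gtr0_norm r0) -sqrtr_sqr ltr_sqrt// exprn_gt0.
by apply/seteqP; split => y; rewrite /eball /enorm /= H.
Qed.

Lemma closed_eballE x r : 0 < r -> closed_eball x r = [set y | dot (y - x) (y - x) <= r ^+ 2].
Proof.
move=> r0; have H d : (Num.sqrt d <= r) = (d <= r ^+ 2).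
  by rewrite -[in LHS](gtr0_norm r0) -sqrtr_sqr ler_sqrt// exprn_ge0// ltW.
by apply/seteqP; split => y; rewrite /closed_eball /enorm /= H.
Qed.

Lemma eball_open x r : 0 < r -> open (eball x r).
Proof.
move=> r0; rewrite eballE//.
apply: (@open_comp _ _ (fun y => dot (y - x) (y - x)) [set t | t < r ^+ 2]); last exact: open_lt.
by move=> y _; exact: dot_sub_continuous.
Qed.

Lemma measurable_eball x r : 0 < r -> measurable (eball x r : set (borel R m)).
Proof. by move=> r0; apply: sub_sigma_algebra; exact: eball_open. Qed.

Lemma sub_eball_closed x r : eball x r `<=` closed_eball x r.
Proof. by move=> y /ltW. Qed.

Lemma closed_eball_closed x r : 0 < r -> closed (closed_eball x r).
Proof.
move=> r0; rewrite closed_eballE//.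
apply: (@closed_comp _ _ (fun y => dot (y - x) (y - x)) [set t | t <= r ^+ 2]); last exact: closed_le.
by move=> y _; exact: dot_sub_continuous.
Qed.

Lemma closed_eball_bounded x r : 0 < r -> entries_bounded (`|x| + r) (closed_eball x r).
Proof.
move=> r0 y; rewrite closed_eballE//= => yr i.
rewrite -[y ord0 i](subrK (x ord0 i)) addrC (le_trans (ler_normD _ _))//.
apply: lerD; first exact: coord_le_norm.
rewrite -(ler_pXn2r (n := 2))// ?nnegrE ?(ltW r0)// real_normK ?num_real//.
apply: le_trans yr; rewrite /dot (bigD1 i)//= !mxE -expr2 lerDl.
by apply: sumr_ge0 => j _; rewrite -expr2 sqr_ge0.
Qed.

Lemma closed_eball_compact x r : 0 < r -> compact (closed_eball x r).
Proof.
by move=> r0; apply: (bounded_entries_compact (closed_eball_bounded r0)); exact: closed_eball_closed.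
Qed.

Lemma closed_eball_star x r y s : 0 < r -> 0 <= s <= 1 ->
  closed_eball x r y -> closed_eball x r (x + s *: (y - x)).
Proof.
move=> r0 /andP[s0 s1]; rewrite closed_eballE//= => yr.
rewrite addrAC subrr add0r dotZl dotZr (le_trans _ yr)// mulrA.
by rewrite ler_piMl ?dot_ge0// -[leRHS](mulr1 1) ler_pM.
Qed.

End euclidean_balls.

Section mean_value_property.
Variables (R : realType) (m : nat) (Omega : set 'rV[R]_m) (u : 'rV[R]_m -> R).
Variables (x0 : 'rV[R]_m) (r : R).
Hypotheses (oOmega : open Omega) (hu : harmonic_on Omega u).
Hypotheses (r0 : 0 < r) (ballOmega : closed_eball x0 r `<=` Omega).
Local Notation leb := (@lebesgue_measure R).
Local Notation e_ i := (unit_vector R i).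
Implicit Types (x y : 'rV[R]_m) (i : 'I_m) (s t : R).

Let du i x : Omega x -> derivable u x (e_ i).
Proof. by have [[_ /(_ i)[d _]] _] := hu; exact: d. Qed.

Let cp i x : Omega x -> {for x, continuous (partial i u)}.
Proof. by have [[_ /(_ i)[_ [c _]]] _] := hu; exact: c. Qed.

Let dp i j x : Omega x -> derivable (partial i u) x (e_ j).
Proof. by have [[_ /(_ i)[_ [_ /(_ j)[d _]]]] _] := hu; exact: d. Qed.

Let cq i j x : Omega x -> {for x, continuous (partial j (partial i u))}.
Proof. by have [[_ /(_ i)[_ [_ /(_ j)[_ c]]]] _] := hu; exact: c. Qed.

Let strict_u x v : Omega x ->
  strictly_derivable u x v (\sum_i v ord0 i * partial i u x).
Proof.
move=> Ox; rewrite [v in strictly_derivable _ _ v _]rV_sum_unit.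
apply: strictly_derivable_sum => i; apply: strictly_derivableZ.
exact: strictly_derivable_unit oOmega Ox (@du i) (@cp i).
Qed.

Let strict_p i x : Omega x ->
  strictly_derivable (partial i u) x (e_ i) (partial i (partial i u) x).
Proof. by move=> Ox; exact: strictly_derivable_unit oOmega Ox (@dp i i) (@cq i i). Qed.

Let K_in y s : closed_eball x0 r y -> 0 <= s <= 1 -> Omega (x0 + s *: (y - x0)).
Proof. by move=> Ky s01; apply: ballOmega; exact: closed_eball_star. Qed.

Let continuous_dilation (g : 'rV[R]_m -> R) y s :
  (forall x, Omega x -> {for x, continuous g}) -> closed_eball x0 r y -> 0 <= s <= 1 ->
  {for y, continuous (fun y => g (x0 + s *: (y - x0)))}.
Proof.
move=> cg Ky s01.
apply: (@continuous_comp _ _ _ (fun y : 'rV[R]_m => x0 + s *: (y - x0)) g); last exact/cg/K_in.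
apply: continuous_rV => i.
have -> : (fun y : 'rV[R]_m => (x0 + s *: (y - x0)) ord0 i) =
    (fun y => x0 ord0 i + s * (y ord0 i - x0 ord0 i)).
  by apply/funext => z; rewrite !mxE.
apply: continuousD; first exact: cst_continuous.
apply: continuousM; first exact: cst_continuous.
by apply: continuousB; [exact: coord_continuous|exact: cst_continuous].
Qed.

Let continuous_line x (a : 'rV[R]_m) t : {for t, continuous (fun t : R => x + t *: a)}.
Proof.
apply: continuous_rV => j.
have -> : (fun t : R => (x + t *: a) ord0 j) = (fun t => x ord0 j + t * a ord0 j).
  by apply/funext => z; rewrite !mxE.
apply: continuousD; first exact: cst_continuous.
by apply: continuousM; [exact: cvg_id|exact: cst_continuous].
Qed.

(* [div_term s i y] is the [i]-th term of the divergence at [y] of the field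
   [y |-> w y *: grad u (x0 + s (y - x0))]; [w] vanishes on the sphere *)
Let w y := 2^-1 * (dot (y - x0) (y - x0) - r ^+ 2).
Let div_term s i y := (y - x0) ord0 i * partial i u (x0 + s *: (y - x0)) +
  w y * (s * partial i (partial i u) (x0 + s *: (y - x0))).

Let div_term_continuous s i y : closed_eball x0 r y -> 0 <= s <= 1 ->
  {for y, continuous (div_term s i)}.
Proof.
move=> Ky s01; apply: continuousD.
  apply: continuousM; last exact: continuous_dilation (@cp i) Ky s01.
  have -> : (fun y : 'rV[R]_m => (y - x0) ord0 i) = (fun y => y ord0 i - x0 ord0 i).
    by apply/funext => z; rewrite !mxE.
  by apply: continuousB; [exact: coord_continuous|exact: cst_continuous].
apply: continuousM.
  apply: continuousM; first exact: cst_continuous.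
  by apply: continuousB; [exact: dot_sub_continuous|exact: cst_continuous].
apply: continuousM; first exact: cst_continuous.
exact: continuous_dilation (@cq i i) Ky s01.
Qed.

Let dot_line x i t : dot (x + t *: (e_ i : 'rV[R]_m) - x0) (x + t *: (e_ i : 'rV[R]_m) - x0) =
  dot (x - x0) (x - x0) - (x - x0) ord0 i ^+ 2 + (t + (x - x0) ord0 i) ^+ 2.
Proof.
rewrite addrAC; move: (x - x0) => v.
by rewrite !(dotDl, dotDr, dotZl, dotZr) (dotC (e_ i)) !dot_unit unit_vectorE eqxx mulr1; ring.
Qed.

(** On the chord cut out by the ball, [div_term s i] is the derivative of [w] times the partial
    derivative of [u] at the dilated point, and [w] vanishes at both ends. *)
Let div_term_line s i x : 0 <= s <= 1 ->
  (\int[leb]_t (((div_term s i) \_ (eball x0 r)) (x + t *: (e_ i : 'rV[R]_m)))%:E = 0)%E.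
Proof.
move=> s01; set vi := (x - x0) ord0 i.
(* The squared half-length of the chord; for [k <= 0] the line misses the open ball. *)
pose k := r ^+ 2 - (dot (x - x0) (x - x0) - vi ^+ 2).
have ballE t : eball x0 r (x + t *: (e_ i : 'rV[R]_m)) <-> (t + vi) ^+ 2 < k.
  by rewrite eballE//= dot_line -/vi /k ltrBrDr addrC.
have [k0|k0] := leP k 0.
  apply: integral0_eq => t _; rewrite patchE memNset// => /ballE.
  by rewrite ltNge (le_trans k0)// sqr_ge0.
pose rho := Num.sqrt k.
have rho0 : 0 < rho by rewrite sqrtr_gt0.
have rhoE : rho ^+ 2 = k by rewrite sqr_sqrtr// ltW.
have ab : - rho - vi < rho - vi by rewrite ltrD2r gtrN.
have inK t : - rho - vi <= t <= rho - vi -> closed_eball x0 r (x + t *: (e_ i : 'rV[R]_m)).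
  move=> /andP[t1 t2]; rewrite closed_eballE//= dot_line -/vi.
  have : (t + vi) ^+ 2 <= rho ^+ 2.
    rewrite -[leLHS]real_normK ?num_real// ler_pXn2r ?nnegrE ?(ltW rho0)//.
    by rewrite ler_norml; apply/andP; split; lra.
  by rewrite rhoE /k; lra.
have openE t : eball x0 r (x + t *: (e_ i : 'rV[R]_m)) <-> t \in `](- rho - vi), (rho - vi)[.
  rewrite ballE in_itv/= -rhoE -[X in X < _ <-> _]real_normK ?num_real//.
  rewrite ltr_pXn2r ?nnegrE ?(ltW rho0)// ltr_norml.
  by split => /andP[h1 h2]; apply/andP; split; lra.
pose phi t := div_term s i (x + t *: (e_ i : 'rV[R]_m)).
transitivity (\int[leb]_(t in `](- rho - vi)%R, (rho - vi)%R[) (phi t)%:E)%E.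
  rewrite [RHS]integral_mkcond; apply: eq_integral => t _.
  rewrite !patchE; case: ifPn; case: ifPn => //; rewrite ?(inE, notin_setE) /=.
    by move=> h1 /openE.
  by move=> /openE.
pose W t := 2^-1 * ((t + vi) ^+ 2 - k).
have WE t : w (x + t *: (e_ i : 'rV[R]_m)) = W t.
  by rewrite /w dot_line -/vi /W /k; congr (_ * _); ring.
pose P t := partial i u (x0 + s *: (x - x0) + t *: (s *: (e_ i : 'rV[R]_m))).
have PE t : x0 + s *: (x + t *: (e_ i : 'rV[R]_m) - x0) =
    x0 + s *: (x - x0) + t *: (s *: (e_ i : 'rV[R]_m)).
  by rewrite addrAC scalerDr addrA !scalerA [t * s]mulrC.
have := @FTC_segment R phi (fun t => W t * P t) _ _ ab.
case.
- move=> t /inK Kt.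
  have dW : is_derive t 1 W (t + vi).
    have h1 : is_derive t 1 (fun t : R => t + vi) 1 by exact: is_derive_shift.
    have h2 := is_deriveZ 2^-1 (is_deriveB (is_deriveM h1 h1) (is_derive_cst k t 1)).
    have -> : W = 2^-1 \*: ((fun t : R => t + vi) * (fun t : R => t + vi) - cst k).
      by apply/funext => z; rewrite /W expr2.
    have -> : t + vi = 2^-1 *: (((t + vi) *: (1 : R) + (t + vi) *: (1 : R)) - 0).
      by rewrite subr0 [(t + vi) *: 1]mulr1 -[RHS]/(2^-1 * (t + vi + (t + vi))); field.
    exact: h2.
  have dP : is_derive t 1 P (s * partial i (partial i u)
      (x0 + s *: (x - x0) + t *: (s *: (e_ i : 'rV[R]_m)))).
    apply: is_derive_strict; apply: strictly_derivableZ; apply: strict_p.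
    by rewrite -PE; exact: K_in.
  suff -> : phi t = W t *: (s * partial i (partial i u)
      (x0 + s *: (x - x0) + t *: (s *: (e_ i : 'rV[R]_m)))) + P t *: (t + vi).
    exact: is_deriveM.
  rewrite /phi /div_term WE PE addrC -/(P t); congr (_ + _).
  by rewrite -[RHS]/(P t * (t + vi)) addrAC add_scale_rVE unit_vectorE eqxx mulr1 -/vi mulrC [t + vi]addrC.
- move=> t /inK Kt.
  apply: (@continuous_comp _ _ _ (fun t : R => x + t *: (e_ i : 'rV[R]_m)) (div_term s i)).
    exact: continuous_line.
  exact: div_term_continuous.
move=> _ ->; congr (_%:E).
have W0 t : (t + vi) ^+ 2 = k -> W t = 0 by rewrite /W => ->; rewrite subrr mulr0.
by rewrite !W0 ?mul0r ?subrr// subrK ?sqrrN rhoE.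
Qed.

Let div_term_bounded_measurable s i : 0 <= s <= 1 ->
  bounded_measurable ((div_term s i) \_ (eball x0 r)).
Proof.
move=> s01; apply: (@restrict_bounded_measurable _ _ (closed_eball x0 r)).
- exact: closed_eball_compact.
- exact: sub_eball_closed.
- exact: measurable_eball.
- by move=> y Ky; apply: continuous_within; exact: div_term_continuous.
Qed.

Let radial y s := \sum_i (y - x0) ord0 i * partial i u (x0 + s *: (y - x0)).

Let integral_radial_ball s : 0 <= s <= 1 ->
  (\int[@lebesgue_rV R m]_y ((radial ^~ s) \_ (eball x0 r) y)%:E = 0)%E.
Proof.
move=> s01.
have E y : (((radial ^~ s) \_ (eball x0 r)) y)%:E =
    (\sum_i (((div_term s i) \_ (eball x0 r)) y)%:E)%E.
  rewrite sumEFin; congr (_%:E); rewrite patchE; case: ifPn => yB; last first.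
    by rewrite big1// => i _; rewrite patchE (negbTE yB).
  under eq_bigr do rewrite patchE yB.
  rewrite big_split /= -mulr_sumr -mulr_sumr.
  have -> : \sum_i partial i (partial i u) (x0 + s *: (y - x0)) = 0.
    apply: hu.2; apply: K_in => //; apply: sub_eball_closed.
    by rewrite inE in yB.
  by rewrite !mulr0 addr0.
under eq_integral do rewrite E.
rewrite integral_sum//; last first.
  by move=> i; exact: bounded_measurable_integrable (div_term_bounded_measurable i s01).
apply: big1 => i _; apply: (integral_coordinate_zero (div_term_bounded_measurable i s01)) => x.
exact: div_term_line.
Qed.

Let integral_ray y : closed_eball x0 r y ->
  (\int[leb]_(s in `[0%R, 1%R]) (radial y s)%:E = (u y - u x0)%:E)%E.
Proof.
move=> Ky.
have := @FTC_segment R (radial y) (fun s => u (x0 + s *: (y - x0))) 0 1 ltr01.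
have -> : x0 + 1 *: (y - x0) = y by rewrite scale1r addrC subrK.
rewrite scale0r addr0; case=> //.
- by move=> s s01; apply: is_derive_strict; apply: strict_u; exact: K_in.
- move=> s s01; apply: continuous_sum => i.
  apply: continuousM; first exact: cst_continuous.
  apply: (@continuous_comp _ _ _ (fun s : R => x0 + s *: (y - x0)) (partial i u)).
    exact: continuous_line.
  by apply: cp; exact: K_in.
Qed.

Let head (z : 'rV[R]_m.+1) := z ord0 (lshift m ord0 : 'I_(1 + m)).
Let tail (z : 'rV[R]_m.+1) : 'rV[R]_m := \row_j z ord0 (rshift 1 j : 'I_(1 + m)).

Let head_cons s y : head (rV_cons (s, y)) = s.
Proof. by rewrite /head rV_cons0. Qed.

Let tail_cons s y : tail (rV_cons (s, y)) = y.
Proof. by apply/rowP => j; rewrite mxE rV_consS. Qed.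

(** The ray parameter becomes an extra first coordinate, so that [integral_rVS] in dimension [m.+1]
    exchanges the integrals over [s] and over the ball. *)
Let G z := radial (tail z) (head z).

Let G_continuous z : 0 <= head z <= 1 -> closed_eball x0 r (tail z) -> {for z, continuous G}.
Proof.
move=> z01 Kz; apply: continuous_sum => i; apply: continuousM.
  have -> : (fun z : 'rV[R]_m.+1 => (tail z - x0) ord0 i) =
      (fun z => z ord0 (rshift 1 i : 'I_(1 + m)) - x0 ord0 i).
    by apply/funext => z'; rewrite !mxE.
  by apply: continuousB; [exact: coord_continuous|exact: cst_continuous].
apply: (@continuous_comp _ _ _ (fun z => x0 + head z *: (tail z - x0)) (partial i u)); last first.
  by apply: cp; exact: K_in.
apply: continuous_rV => j.
have -> : (fun z : 'rV[R]_m.+1 => (x0 + head z *: (tail z - x0)) ord0 j) =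
    (fun z => x0 ord0 j + z ord0 (lshift m ord0 : 'I_(1 + m)) *
      (z ord0 (rshift 1 j : 'I_(1 + m)) - x0 ord0 j)).
  by apply/funext => z'; rewrite !mxE.
apply: continuousD; first exact: cst_continuous.
apply: continuousM; first exact: coord_continuous.
by apply: continuousB; [exact: coord_continuous|exact: cst_continuous].
Qed.

Let tail_continuous : continuous tail.
Proof.
move=> z; apply: continuous_rV => j.
have -> : (fun z => tail z ord0 j) = (fun z => z ord0 (rshift 1 j : 'I_(1 + m))).
  by apply/funext => z'; rewrite mxE.
exact: coord_continuous.
Qed.

Let slab_closed : closed [set z | 0 <= head z <= 1].
Proof.
have -> : [set z | 0 <= head z <= 1] = head @^-1` `[0, 1]%classic.
  by apply/seteqP; split => z; rewrite /= in_itv.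
by apply: closed_comp => [z _|]; [exact: coord_continuous|exact: itv_closed].
Qed.

Let G_bounded_measurable :
  bounded_measurable (G \_ [set z | 0 <= head z <= 1 /\ eball x0 r (tail z)]).
Proof.
apply: (@restrict_bounded_measurable _ _ [set z | 0 <= head z <= 1 /\ closed_eball x0 r (tail z)]).
- apply: (@bounded_entries_compact _ _ (Num.max 1 (`|x0| + r))).
    move=> z [/andP[z0 z1] Kz] i; rewrite le_max.
    case: (@split_ordP 1 m i) => j ->.
      by rewrite (ord1 j) ger0_norm ?z1.
    by have := closed_eball_bounded r0 Kz j; rewrite mxE => ->; rewrite orbT.
  have -> : [set z | 0 <= head z <= 1 /\ closed_eball x0 r (tail z)] =
    [set z | 0 <= head z <= 1] `&` tail @^-1` (closed_eball x0 r) by [].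
  apply: closedI; first exact: slab_closed.
  by apply: closed_comp => [z _|]; [exact: tail_continuous|exact: closed_eball_closed].
- by move=> z [h1 /sub_eball_closed].
- have -> : [set z | 0 <= head z <= 1 /\ eball x0 r (tail z)] =
    [set z | 0 <= head z <= 1] `&` tail @^-1` (eball x0 r) by [].
  apply: measurableI; first by apply: closed_borel; exact: slab_closed.
  apply: sub_sigma_algebra; apply: open_comp => [z _|]; last exact: eball_open.
  exact: tail_continuous.
- by move=> z [z01 Kz]; apply: continuous_within; exact: G_continuous.
Qed.

Let u_continuous x : Omega x -> {for x, continuous u}.
Proof. by have [[c _] _] := hu; exact: c. Qed.

Lemma harmonic_mean_value :
  (@lebesgue_rV R m).-integrable (eball x0 r) (EFin \o u : borel R m -> \bar R) /\
  (\int[@lebesgue_rV R m]_(y in eball x0 r) (u y)%:E = (u x0)%:E * lebesgue_rV (eball x0 r : set (borel R m)))%E.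
Proof.
have mB := measurable_eball x0 r0.
have ibd (f : 'rV[R]_m -> R) : (forall x, Omega x -> {for x, continuous f}) ->
    (@lebesgue_rV R m).-integrable (eball x0 r) (EFin \o f : borel R m -> \bar R).
  move=> cf; apply/(integrable_mkcond _ mB).
  have := @bounded_measurable_integrable R m (f \_ (eball x0 r)).
  rewrite -restrict_EFin; apply; apply: (@restrict_bounded_measurable _ _ (closed_eball x0 r)) => //.
  - exact: closed_eball_compact.
  - exact: sub_eball_closed.
  - by move=> y Ky; apply: continuous_within; exact/cf/ballOmega.
have iu := ibd u u_continuous; split => //.
have [E1 E2] := integral_rVS G_bounded_measurable.
(* Integrating [G] over [s] first gives [u y - u x0] for each [y]; integrating over [y] first gives
   0 for each [s]. *)
have Z : (\int[@lebesgue_rV R m]_(y in eball x0 r) ((u y)%:E - (u x0)%:E) = 0)%E.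
  transitivity (\int[@lebesgue_rV R m.+1]_z
      ((G \_ [set z | 0 <= head z <= 1 /\ eball x0 r (tail z)]) z)%:E)%E.
    rewrite E2 integral_mkcond; apply: eq_integral => y _.
    rewrite patchE; case: ifPn => yB.
      rewrite -EFinB -integral_ray; last by apply: sub_eball_closed; rewrite inE in yB.
      rewrite [LHS]integral_mkcond; apply: eq_integral => s _.
      rewrite !patchE /G head_cons tail_cons.
      case: ifPn => s01.
        by rewrite mem_set//=; move: s01; rewrite !inE /= head_cons tail_cons in_itv/= in yB *.
      by rewrite memNset// => -[]; move: s01; rewrite notin_setE /= head_cons in_itv.
    apply/esym/integral0_eq => s _.
    rewrite patchE memNset// => -[_]; rewrite tail_cons => yB'.
    by move: yB; rewrite notin_setE.
  rewrite E1; apply: integral0_eq => s _.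
  have [s01|s01] := boolP (0 <= s <= 1); last first.
    apply: integral0_eq => y _; rewrite patchE memNset// => -[].
    by rewrite head_cons (negbTE s01).
  rewrite -[RHS](integral_radial_ball s01); apply: eq_integral => y _.
  rewrite !patchE /G head_cons tail_cons; congr (_%:E).
  case: ifPn; case: ifPn => //; rewrite ?(inE, notin_setE) /= head_cons tail_cons.
    by move=> yB [_ /yB].
  by move=> yB; case.
move: Z; rewrite integralB_EFin//; last by apply: (ibd (fun=> u x0)) => x _; exact: cst_continuous.
rewrite integral_cst//= => /eqP.
rewrite sube_eq; first by rewrite add0e => /eqP.
  exact: integrable_fin_num iu.
by rewrite fin_num_adde_defr.
Qed.

End mean_value_property.

(** * Superharmonicity *)

Section superharmonic_volume_root.
Variables (R : realType) (m n : nat) (Omega : set 'rV[R]_m).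
Variable H : 'rV[R]_m -> 'rV[R]_n -> R.
Hypotheses (n_gt0 : (0 < n)%N) (oOmega : open Omega).
Hypothesis subH : forall x, Omega x -> sublinear (H x).
Hypothesis harmH : forall xi, harmonic_on Omega (fun x => H x xi).
Local Notation leb := (@lebesgue_rV R m).
Local Notation V := (@volume_root R n).
Implicit Types (x y : 'rV[R]_m) (xi : 'rV[R]_n) (S : set 'rV[R]_m).

Let Omega_near x : Omega x -> \forall y \near x, Omega y.
Proof. by move=> Ox; exact: open_nbhs_nbhs. Qed.

Let cH xi x : Omega x -> {for x, continuous (fun y => H y xi)}.
Proof. by have [[c _] _] := harmH xi; exact: c. Qed.

Let H_locally_bounded x : Omega x -> exists2 C, 0 < C & \forall y \near x,
  Omega y /\ forall i, H y (unit_vector R i) <= C /\ H y (- unit_vector R i) <= C.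
Proof.
move=> Ox; have [C C0 HC] := sublinear_bound (H x).
exists (C + 1); first by rewrite ltr_wpDl.
have lt v : H x v <= C -> \forall y \near x, H y v <= C + 1.
  move=> hv; have /cvgrPdist_le/(_ 1 ltr01) := @cH v x Ox; apply: filterS => y.
  by rewrite ler_distl => /andP[h1 h2]; lra.
have : \forall y \near x, forall i, H y (unit_vector R i) <= C + 1 /\ H y (- unit_vector R i) <= C + 1.
  apply: (@filter_forall _ _ (fun i => [set y | H y (unit_vector R i) <= C + 1 /\
    H y (- unit_vector R i) <= C + 1]) (nbhs x)) => i; have [h1 h2] := HC i.
  exact: (filterI (lt _ h1) (lt _ h2)).
by move=> h; exact: (filterI (Omega_near Ox) h).
Qed.

(** Near [x] the functions [H y] share a Lipschitz constant, so closeness in one direction extends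
    to nearby directions; compactness of the unit sphere and homogeneity give all directions. *)
Let H_near x e : Omega x -> 0 < e -> \forall y \near x, Omega y /\
  forall xi, `|H y xi - H x xi| <= e * onenorm xi.
Proof.
move=> Ox e0; have [C C0 HC] := H_locally_bounded Ox.
have := @onenorm_sphere_compact R n => /compact_near_coveringP.
move=> /(_ _ (nbhs x) (fun y xi => `|H y xi - H x xi| <= e)) cov.
have : \forall y \near x, [set xi : 'rV[R]_n | onenorm xi = 1] `<=`
    (fun xi => `|H y xi - H x xi| <= e).
  apply: cov => xi0 _.
  (* The triangle inequality will use [e / 4] for each change of direction, through the Lipschitz
     constant [C], and [e / 2] for the change of point. *)
  have d0 : 0 < e / (4 * C) by rewrite divr_gt0// mulr_gt0.
  have nearxi : \forall xi \near xi0, onenorm (xi - xi0) <= e / (4 * C).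
    have : {for xi0, continuous (fun xi : 'rV[R]_n => onenorm (xi - xi0))}.
      apply: continuous_sum => i.
      have -> : (fun y : 'rV[R]_n => `|(y - xi0) ord0 i|) =
          Num.norm \o (fun y : 'rV[R]_n => y ord0 i - xi0 ord0 i).
        by apply/funext => z; rewrite /= !mxE.
      apply: continuous_comp; last exact: norm_continuous.
      by apply: continuousB; [exact: coord_continuous|exact: cst_continuous].
    move=> /cvgrPdist_le/(_ _ d0); apply: filterS => xi.
    rewrite subrr (sublinear0 (@sublinear_onenorm R n)) sub0r normrN.
    by apply: le_trans; exact: ler_norm.
  have neary : \forall y \near x, `|H y xi0 - H x xi0| <= e / 2.
    have e2 : 0 < e / 2 by rewrite divr_gt0.
    by have /cvgrPdist_le/(_ _ e2) := @cH xi0 x Ox; apply: filterS => y; rewrite distrC.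
  exists ([set xi | onenorm (xi - xi0) <= e / (4 * C)],
    [set y | (Omega y /\ forall i, H y (unit_vector R i) <= C /\ H y (- unit_vector R i) <= C) /\
      `|H y xi0 - H x xi0| <= e / 2]).
    by split => //; exact: filterI.
  move=> [xi y] [/= hxi [[Oy hy] hyx]].
  have [_ hx] := nbhs_singleton HC.
  have l1 := sublinear_lipschitz (subH Oy) hy xi xi0.
  have l2 := sublinear_lipschitz (subH Ox) hx xi0 xi.
  have N : C * onenorm (xi - xi0) <= e / 4.
    rewrite mulrC -ler_pdivlMr// (le_trans hxi)// invfM mulrA//.
  rewrite -(opprB xi xi0) onenormN in l2.
  have -> : H y xi - H x xi = (H y xi - H y xi0) + (H y xi0 - H x xi0) + (H x xi0 - H x xi) by ring.
  apply: le_trans (ler_normD _ _) _; apply: le_trans (lerD (ler_normD _ _) (lexx _)) _.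
  by move: l1 l2 N hyx; lra.
apply: filterS2 (Omega_near Ox) => y Oy Hy; split => // xi.
have [xi0|xi0] := eqVneq (onenorm xi) 0.
  rewrite (sublinear_onenorm_eq0 (subH Oy) xi0) (sublinear_onenorm_eq0 (subH Ox) xi0).
  by rewrite subrr normr0 xi0 mulr0.
have N0 : 0 < onenorm xi by rewrite lt_neqAle eq_sym xi0 onenorm_ge0.
have := Hy ((onenorm xi)^-1 *: xi); rewrite /= (@sublinear_onenorm R n).2 ?invr_ge0 ?(ltW N0)//.
rewrite mulVf// => /(_ erefl).
rewrite !(subH _).2 ?invr_ge0 ?(ltW N0)// -mulrBr normrM ger0_norm ?invr_ge0 ?(ltW N0)//.
by rewrite ler_pdivrMl// mulrC.
Qed.

Lemma volume_root_lower_semicontinuous x a : Omega x -> a < V (H x) ->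
  \forall y \near x, a < V (H y).
Proof.
move=> Ox ax; have [e e0 he] := volume_root_lsc n_gt0 (subH Ox) ax.
apply: filterS (H_near Ox e0) => y [Oy hy]; apply: he; first exact: subH.
by move=> xi; have := hy xi; rewrite ler_distl => /andP[].
Qed.

(** Lower semicontinuity makes the superlevel sets in [Omega] open. *)
Let V_measurable S : S `<=` Omega -> measurable (S : set (borel R m)) ->
  measurable_fun (S : set (borel R m)) (fun y => (V (H y))%:E : \bar R).
Proof.
move=> SO mS.
have mO : measurable (Omega : set (borel R m)) by exact: sub_sigma_algebra.
apply: (@measurable_funS _ _ _ _ (Omega : set (borel R m))) => //.
apply/measurable_EFinP; apply: (measurability _ (RGenOInfty.measurableE R)).
move=> _ [_ [a ->] <-]; apply: sub_sigma_algebra.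
rewrite openE => x [Ox /=]; rewrite in_itv/= andbT => ax.
apply: filterS2 (Omega_near Ox) (volume_root_lower_semicontinuous Ox ax) => y Oy ay.
by split => //=; rewrite in_itv/= andbT.
Qed.

Section ball.
Variables (x : 'rV[R]_m) (r : R).
Hypotheses (r0 : 0 < r) (xrO : closed_eball x r `<=` Omega).
Local Notation B := (eball x r).
Local Notation meas S := (lebesgue_rV (S : set (borel R m))).

Let mB : measurable (B : set (borel R m)). Proof. exact: measurable_eball. Qed.

Let lty_meas S : measurable (S : set (borel R m)) -> S `<=` B -> (meas S < +oo)%E.
Proof.
move=> mS SB; apply: (@lebesgue_rV_lty _ _ (`|x| + r)) => // y /SB/sub_eball_closed.
exact: closed_eball_bounded.
Qed.

Let fine_meas S : measurable (S : set (borel R m)) -> S `<=` B -> (fine (meas S))%:E = meas S.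
Proof. by move=> mS SB; rewrite fineK// ge0_fin_numE//; exact: lty_meas. Qed.

Let BO : B `<=` Omega.
Proof. by move=> y /sub_eball_closed/xrO. Qed.

Let iH xi S : measurable (S : set (borel R m)) -> S `<=` B ->
  leb.-integrable S (EFin \o (fun y : borel R m => H y xi)).
Proof.
move=> mS SB; have [iB _] := harmonic_mean_value oOmega (harmH xi) r0 xrO.
exact: (integrableS mB mS SB iB).
Qed.

(* Riemann sum: [g] is a finite combination of the functions [H c] *)
Let partition_bound e (s : seq 'rV[R]_m) : 0 < e ->
  (forall c, c \in s -> Omega c) -> forall S,
  measurable (S : set (borel R m)) -> S `<=` B ->
  (forall y, S y -> exists2 c, c \in s &
     [set y | forall xi, `|H y xi - H c xi| <= e * onenorm xi]° y) ->
  exists g, [/\ sublinear g,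
    forall xi, g xi <= \int[leb]_(y in S) (H y xi) + 2 * e * fine (meas S) * onenorm xi &
    (\int[leb]_(y in S) (V (H y))%:E <= (V g)%:E)%E].
Proof.
move=> e0; elim: s => [|c s IH] Os S mS SB cov.
  have -> : S = set0 by apply/seteqP; split => // y /cov[].
  exists (fun=> 0); split.
  - by split=> [? ?|? ? _]; rewrite ?addr0 ?mulr0.
  - by move=> xi; rewrite Rintegral_set0 measure0/= mulr0 mul0r addr0.
  - by rewrite integral_set0 lee_fin volume_root_ge0.
have Oc : Omega c by apply: Os; rewrite mem_head.
set U := [set y | forall xi, `|H y xi - H c xi| <= e * onenorm xi]°.
have mU : measurable (U : set (borel R m)) by apply: sub_sigma_algebra; exact: open_interior.
(* Removing the part near [c] makes the pieces of the partition disjoint; the remaining centres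
   cover [S2]. *)
pose S1 := S `&` U; pose S2 := S `\` U.
have mS1 : measurable (S1 : set (borel R m)) by exact: measurableI.
have mS2 : measurable (S2 : set (borel R m)) by exact: measurableD.
have S1B : S1 `<=` B by move=> y [/SB].
have S2B : S2 `<=` B by move=> y [/SB].
have S12 : [disjoint S1 & S2].
  by apply/disj_setPS => y [[_ Uy] [_ nUy]]; case: nUy.
have SE : S = S1 `|` S2 by rewrite /S1 /S2 setUIDK.
have [||g2 [sg2 g2H g2V]] := IH _ S2 mS2 S2B.
- by move=> d ds; apply: Os; rewrite inE ds orbT.
- move=> y [Sy nUy]; have [d] := cov y Sy; rewrite inE => /predU1P[->//|ds Ud].
  by exists d.
(* On [S1] this dominates every [H y], so [V h] bounds [V (H y)]; it exceeds [H y] by at most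
   [2 * e * onenorm xi], whence the factor 2 in the claim. *)
pose h xi := H c xi + e * onenorm xi.
have sh : sublinear h.
  have := sublinear_comb ler01 (ltW e0) (subH Oc) (@sublinear_onenorm R n).
  by congr sublinear; apply/funext => xi; rewrite mul1r.
pose s1 := fine (meas S1).
have s10 : 0 <= s1 by exact: fine_ge0.
exists (fun xi => s1 * h xi + 1 * g2 xi); split.
- exact: sublinear_comb.
- move=> xi; rewrite SE Rintegral_setU//; last first.
    by rewrite -SE; exact: iH.
  have -> : fine (meas (S1 `|` S2)) = s1 + fine (meas S2).
    rewrite measureU//; last exact/disj_set2P.
    by rewrite fineD// ge0_fin_numE//; exact: lty_meas.
  have : s1 * (H c xi - e * onenorm xi) <= \int[leb]_(y in S1) (H y xi).
    rewrite mulrC /s1 -Rintegral_cst//; apply: le_Rintegral => //.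
    + apply: measurable_bounded_integrable => //; first exact: lty_meas.
      by exists `|H c xi - e * onenorm xi|; split => // K KL y _ /=; exact: ltW.
    + exact: iH.
    + move=> y [_ /interior_subset/(_ xi)]; rewrite ler_distl => /andP[? _]; lra.
  have := g2H xi; rewrite /h; lra.
- rewrite SE ge0_integral_setU//; last 2 first.
    by rewrite -SE; apply: V_measurable => // y /SB/BO.
    by move=> y _; rewrite lee_fin volume_root_ge0.
  apply: (@le_trans _ _ (s1 * V h + 1 * V g2)%:E); last first.
    by rewrite lee_fin; apply: volume_root_concave.
  rewrite EFinD mul1r; apply: leeD => //.
  rewrite EFinM muleC /s1 fine_meas// -integral_cst//.
  apply: ge0_le_integral => //.
  + by move=> y _; rewrite lee_fin volume_root_ge0.
  + by apply: V_measurable => // y /S1B/BO.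
  + move=> y [_ /interior_subset Uy]; rewrite lee_fin; apply: volume_root_mono => // xi.
    by have := Uy xi; rewrite ler_distl => /andP[_].
Qed.

Lemma volume_root_mean_ineq :
  (\int[leb]_(y in B) (V (H y))%:E <= meas B * (V (H x))%:E)%E.
Proof.
have Ox : Omega x by apply: xrO; rewrite closed_eballE//= subrr -(scale0r 0) dotZl mul0r exprn_ge0// ltW.
pose beta := fine (meas B); have betaE : beta%:E = meas B by exact: fine_meas.
(* In the null case both sides are 0; the other case divides by [beta]. *)
have [beta0|beta0] := leP beta 0.
  have B0 : meas B = 0%E by apply: le_anti; rewrite -betaE lee_fin beta0 betaE measure_ge0.
  by rewrite B0 mul0e null_set_integral//; exact: V_measurable.
have ap e : 0 < e -> (\int[leb]_(y in B) (V (H y))%:E <=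
    (beta * V (fun xi => H x xi + 2 * e * onenorm xi))%:E)%E.
  move=> e0.
  have := @closed_eball_compact R m x r r0; rewrite compact_cover.
  move=> /(_ _ (closed_eball x r) (fun c => [set y | forall xi, `|H y xi - H c xi| <= e * onenorm xi]°)).
  case.
  - by move=> c _; exact: open_interior.
  - move=> c Kc; exists c => //; rewrite /interior /=.
    by apply: filterS (H_near (xrO Kc) e0) => y [].
  move=> D DK cov.
  have [||g [sg gH gV]] := partition_bound (s := finmap.enum_fset D) e0 _ mB (@subset_refl _ _).
  - by move=> c cD; apply: xrO; have := DK c cD; rewrite inE.
  - by move=> y /sub_eball_closed/cov[c cD cy]; exists c.
  apply: le_trans gV _; rewrite lee_fin -ler_pdivrMl//.
  (* The required half of homogeneity is concavity with second weight 0. *)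
  apply: le_trans (_ : V (fun xi => beta^-1 * g xi + 0 * g xi) <= _).
    have b0 : 0 <= beta^-1 by rewrite invr_ge0 ltW.
    by have := volume_root_concave n_gt0 b0 (lexx 0) sg sg; rewrite mul0r addr0.
  apply: volume_root_mono => // xi; rewrite mul0r addr0 ler_pdivrMl//.
  apply: le_trans (gH xi) _; rewrite -/beta /Rintegral.
  have [_ ->] := harmonic_mean_value oOmega (harmH xi) r0 xrO.
  by rewrite -betaE -EFinM /=; lra.
have fin : (\int[leb]_(y in B) (V (H y))%:E)%E \is a fin_num.
  rewrite ge0_fin_numE; first exact: le_lt_trans (ap 1 ltr01) (ltry _).
  by apply: integral_ge0 => y _; rewrite lee_fin volume_root_ge0.
rewrite -betaE -(fineK fin) -EFinM lee_fin -ler_pdivrMl//.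
apply: volume_root_limit => // k; rewrite ler_pdivrMl// -lee_fin (fineK fin).
(* This [e] turns the error [2 * e] into the [k.+1%:R^-1] of [volume_root_limit]. *)
have e0 : 0 < 2^-1 * k.+1%:R^-1 :> R by rewrite mulr_gt0// invr_gt0.
have := ap _ e0; have -> // : 2 * (2^-1 * k.+1%:R^-1) = k.+1%:R^-1 :> R.
by rewrite mulrA mulfV// mul1r.
Qed.

End ball.

Lemma superharmonic_volume_root : superharmonic Omega (fun x => V (H x)).
Proof.
split=> [x a|x r]; first exact: volume_root_lower_semicontinuous.
exact: volume_root_mean_ineq.
Qed.

End superharmonic_volume_root.

(** * Support functions and the Hausdorff distance *)

Section hausdorff.
Variables (R : realType) (n : nat).
Implicit Types (A B : set 'rV[R]_n) (x y xi : 'rV[R]_n).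

Lemma coord_le_enorm x i : `|x ord0 i| <= enorm x.
Proof.
rewrite /enorm -sqrtr_sqr ler_sqrt ?dot_ge0// /dot (bigD1 i)//= -expr2 lerDl.
by apply: sumr_ge0 => j _; rewrite -expr2 sqr_ge0.
Qed.

Lemma dot_le_enorm_onenorm x xi : dot x xi <= enorm x * onenorm xi.
Proof.
rewrite /dot /onenorm mulr_sumr; apply: ler_sum => i _.
rewrite (le_trans (ler_norm _))// normrM ler_wpM2r//; exact: coord_le_enorm.
Qed.

Lemma support_function_enlargement A B e xi : convex_body A -> convex_body B ->
  A `<=` enlargement B e -> support_function A xi <= support_function B xi + e * onenorm xi.
Proof.
move=> [[a Aa] _ _] [_ cB _] AB; apply: ge_sup; first by exists (dot a xi), a.
move=> _ [z Az <-]; have [x Bx zx] := AB z Az.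
rewrite -[z](subrK x) addrC dotDl; apply: lerD; first exact: dot_le_support.
by apply: le_trans (dot_le_enorm_onenorm _ _) _; rewrite ler_wpM2r ?onenorm_ge0.
Qed.

Lemma compact_entries_bounded A : compact A -> exists M, entries_bounded M A.
Proof.
move=> cA; have [M [_ hM]] := compact_bounded cA.
by exists (M + 1) => x Ax i; apply: le_trans (coord_le_norm x i) (hM _ _ x Ax); rewrite ltrDl.
Qed.

(** The strict bound by [d] yields an admissible enlargement radius below [d], whether or not the
    infimum is attained. *)
Lemma support_function_hausdorff A B d xi : convex_body A -> convex_body B ->
  hausdorff_distance A B < d ->
  `|support_function A xi - support_function B xi| <= d * onenorm xi.
Proof.
move=> bA bB; rewrite /hausdorff_distance; set E := [set e | _] => hd.
have [[a Aa] cA _] := bA; have [[b Bb] cB _] := bB.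
have hE : has_inf E.
  split; last by exists 0 => e [].
  have [M1 h1] := compact_entries_bounded cA; have [M2 h2] := compact_entries_bounded cB.
  (* This bounds every distance between points of [A] and [B], so the infimum is over a nonempty set
     and is not a default value. *)
  pose e := Num.sqrt (\sum_(i < n) (M1 + M2) ^+ 2).
  have near x y : A x -> B y -> enorm (y - x) <= e.
    move=> /h1 Ax /h2 By; rewrite ler_sqrt; last by apply: sumr_ge0 => i _; exact: sqr_ge0.
    apply: ler_sum => i _; rewrite -expr2 -[leLHS]real_normK ?num_real//.
    have M : `|(y - x) ord0 i| <= M1 + M2.
      by rewrite !mxE (le_trans (ler_normB _ _))// addrC lerD.
    by rewrite ler_pXn2r ?nnegrE// (le_trans _ M).
  exists e; split; first exact: sqrtr_ge0.
    move=> x Ax; exists b => //.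
    by have := near x b Ax Bb; rewrite /enorm -opprB dotNl dotNr opprK.
  by move=> y By; exists a => //; exact: near.
have d0 : 0 < d - inf E by rewrite subr_gt0.
have [e [e0 AB BA]] := inf_adherent d0 hE.
rewrite addrC subrK => ed.
have h1 := support_function_enlargement xi bA bB AB.
have h2 := support_function_enlargement xi bB bA BA.
have h3 := ler_wpM2r (onenorm_ge0 xi) (ltW ed).
by rewrite ler_distl; apply/andP; split; lra.
Qed.

End hausdorff.

(** * The support function of the harmonic interpolation *)

Section harmonic_interpolation_support.
Variables (R : realType) (m n : nat) (Omega : set 'rV[R]_m).
Variable A : 'rV[R]_m -> set 'rV[R]_n.
Hypothesis bOmega : bounded_set Omega.
Hypothesis hbody : forall t, boundary Omega t -> convex_body (A t).
Hypothesis hcont : continuous_family (boundary Omega) A.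

Lemma boundary_closed : closed (boundary Omega).
Proof.
rewrite /boundary setDE; apply: closedI; first exact: closed_closure.
exact/open_closedC/open_interior.
Qed.

Lemma boundary_compact : compact (boundary Omega).
Proof.
have [M [_ hM]] := bOmega.
apply: (@bounded_entries_compact _ _ (M + 1)); last exact: boundary_closed.
have cN : closed [set x : 'rV[R]_m | `|x| <= M + 1].
  apply: (@closed_comp _ _ (fun x : 'rV[R]_m => `|x|) [set t | t <= M + 1]); last exact: closed_le.
  by move=> x _; exact: norm_continuous.
have sub : Omega `<=` [set x | `|x| <= M + 1] by move=> y Oy; apply: hM => //; rewrite ltrDl.
move=> x [clx _] i; apply: le_trans (coord_le_norm x i) _.
by have := closureS sub clx; rewrite -((closure_id _).1 cN).
Qed.

(** This makes the support function in direction [xi] admissible boundary data for the harmonic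
    measure. *)
Lemma support_family_continuous xi t : boundary Omega t ->
  support_function (A s) xi @[s --> within (boundary Omega) (nbhs t)] --> support_function (A t) xi.
Proof.
move=> bt; apply/(@cvgrPdist_le _ _ _ (within (boundary Omega) (nbhs t))) => e e0.
have N1 : 0 < onenorm xi + 1 by rewrite ltr_wpDl// onenorm_ge0.
have d0 : 0 < e / (onenorm xi + 1) by rewrite divr_gt0.
have /cvgrPdist_lt/(_ _ d0) := hcont bt.
rewrite !near_withinE; apply: filterS => s hs bs.
have := hs bs; rewrite sub0r normrN => /(le_lt_trans (ler_norm _)) hd.
rewrite distrC; apply: le_trans (support_function_hausdorff xi (hbody bs) (hbody bt) hd) _.
by rewrite mulrAC ler_pdivrMr// ler_wpM2l ?(ltW e0)// lerDl.
Qed.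

Lemma support_family_integrable (P : probability (borel R m) R) xi :
  P.-integrable (boundary Omega) (EFin \o (fun t : borel R m => support_function (A t) xi)).
Proof.
have cf := @support_family_continuous xi.
have mb : measurable (boundary Omega : set (borel R m)).
  by apply: closed_borel; exact: boundary_closed.
apply: measurable_bounded_integrable => //.
- by apply: (@le_lt_trans _ _ 1%E); [exact: probability_le1|rewrite ltry].
- exact: within_continuous_measurable.
have wf : {within boundary Omega, continuous (fun t => support_function (A t) xi)}.
  exact/subspace_continuousP.
have [K [Kr hK]] := compact_bounded (continuous_compact wf boundary_compact).
by exists K; split => // L KL t bt; apply: hK KL _ _; exists t.
Qed.

Lemma interpolated_support_sublinear (P : probability (borel R m) R) :
  sublinear (fun xi => \int[P]_(t in boundary Omega) support_function (A t) xi).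
Proof.
have mb : measurable (boundary Omega : set (borel R m)).
  by apply: closed_borel; exact: boundary_closed.
split=> [x y|a x a0].
  rewrite -RintegralD//; try exact: support_family_integrable.
  apply: le_Rintegral => //; first exact: support_family_integrable.
    have := integrableD mb (support_family_integrable P x) (support_family_integrable P y).
    by [].
  by move=> t bt; have [sD _] := support_function_sublinear (hbody bt); exact: sD.
rewrite -RintegralZl//; last exact: support_family_integrable.
apply: eq_Rintegral => t; rewrite inE => bt.
by have [_ sZ] := support_function_sublinear (hbody bt); exact: sZ.
Qed.

End harmonic_interpolation_support.

Lemma superharmonic_ext (R : realType) (m : nat) (Omega : set 'rV[R]_m) (f g : 'rV[R]_m -> R) :
  open Omega -> (forall x, Omega x -> f x = g x) ->
  superharmonic Omega f -> superharmonic Omega g.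
Proof.
move=> oO fg [lsc mean]; split => [x a Ox ax|x r r0 xr].
  have := lsc x a Ox; rewrite fg// => /(_ ax); have : nbhs x Omega by exact: open_nbhs_nbhs.
  by apply: filterS2 => y Oy; rewrite fg.
have Ox : Omega x.
  by apply: xr; rewrite closed_eballE//= subrr -(scale0r 0) dotZl mul0r exprn_ge0// ltW.
rewrite -(fg _ Ox) (le_trans _ (mean x r r0 xr))//.
rewrite (eq_integral (fun y : borel R m => (f y)%:E))// => y; rewrite inE => yB.
by rewrite fg//; apply: xr; exact: sub_eball_closed.
Qed.

Theorem theorem2p2 (R : realType) (m n : nat) (hm : (1 <= m)%N) (hn : (1 <= n)%N)
    (Omega : set 'rV[R]_m) (hOmega : smoothly_bounded_domain Omega)
    (A : 'rV[R]_m -> set 'rV[R]_n)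
    (hbody : forall t : 'rV[R]_m, boundary Omega t -> convex_body (A t))
    (hcont : continuous_family (boundary Omega) A)
    (mu : 'rV[R]_m -> probability (borel R m) R)
    (hmu : harmonic_measure Omega mu) :
  superharmonic Omega (fun x =>
    fine (lebesgue_rV (harmonic_interpolation Omega mu A x)) `^ (n%:R^-1)).
Proof.
have [bO oO _ _] := hOmega.
pose H x xi := \int[mu x]_(t in boundary Omega) support_function (A t) xi.
have subH x : sublinear (H x) by exact: interpolated_support_sublinear bO hbody hcont (mu x).
apply: (@superharmonic_ext _ _ _ (fun x => volume_root (H x))) => // [x _|].
  rewrite /harmonic_interpolation /minkowski_integral body_of_support_wulff//.
  exact: subH.
apply: superharmonic_volume_root => // xi.
apply: (hmu.2 (fun t => support_function (A t) xi) _).1.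
apply/subspace_continuousP => t bt.
exact: support_family_continuous hbody hcont xi t bt.
Qed.
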